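(* Let $w=\beta^+/(\beta^++\beta^-)$ and $w_t=w(\cdot,\cdot,t)$. As $n\to\infty$, $$\int_0^Td_\square\big(H^n_t,w_t\big)\,dt\longrightarrow0\quad\text{almost surely}.$$
   Context: Fix $T\in(0,\infty)$; write $[0,1]^2_T=[0,1]^2\times[0,T]$ and $[n]=\{1,\dots,n\}$. All $L^p$ spaces are with respect to Lebesgue measure. Let $Q^n_1=[0,1/n]$, $Q^n_i=((i-1)/n,i/n]$ for $2\le i\le n$, and $Q^n_{i,j}=Q^n_i\times Q^n_j$. Rates. $\beta^+,\beta^-:[0,1]^2\times[0,T]\to[0,\infty)$ are measurable, with $\beta^\pm_t(x,y)=\beta^\pm(x,y,t)$. For each $n$ and $i,j\in[n]$, $\beta^{n,\pm}_{i,j}:[0,T]\to[0,\infty)$ are measurable and $\beta^{n,\pm}_t(x,y)=\beta^{n,\pm}(x,y,t)=\sum_{i,j=1}^n\beta^{n,\pm}_{i,j}(t)\mathbf 1_{Q^n_{i,j}}(x,y)$. Standing assumptions: (a) $\beta^{n,\pm},\beta^\pm\in L^1([0,1]^2_T)$ and $\beta^{n,\pm}\to\beta^\pm$ in $L^1([0,1]^2_T)$; (b) there is $c_\beta>0$ with $\beta^{n,\pm}_{i,j}(t)\ge c_\beta$ for all $n\ge1$, $i,j\in[n]$, $t\in[0,T]$; (c) $t\mapsto\beta^\pm_t(x,y)$ is bounded and left-continuous for a.e. $(x,y)\in[0,1]^2$, and $t\mapsto\beta^{n,\pm}_{i,j}(t)$ is bounded and left-continuous for all $i,j\in[n]$ and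 all large enough $n$. Graph process. $a(n)\in(0,\infty)$ with $a(n)\to\infty$. For each $n$, $\{X^n_{i,j}(t):t\in[0,T]\}_{i,j\in[n]}$ are $n^2$ mutually independent (càdlàg) Markov chains on $\{0,1\}$, with deterministic initial values $X^n_{i,j}(0)=x^n_{i,j}\in\{0,1\}$, jumping at time $t$ from $0$ to $1$ at rate $a(n)\beta^{n,+}_{i,j}(t)$ and from $1$ to $0$ at rate $a(n)\beta^{n,-}_{i,j}(t)$; all are defined on one probability space $(\Omega,\mathcal F,\mathbb P)$. Put $H^n_t(x,y)=\sum_{i,j=1}^nX^n_{i,j}(t)\mathbf 1_{Q^n_{i,j}}(x,y)$. $\mathcal S_0$ is the set of measurable $f:[0,1]^2\to\mathbb R$ with $0\le f\le1$ a.e. For $f,g\in\mathcal S_0$, $d_\square(f,g)=\sup_{A,B\subseteq[0,1]}\big|\int_{A\times B}(f(x,y)-g(x,y))\,dx\,dy\big|$, the supremum being over measurable sets $A,B$. *)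

(* Defs.v *)
From HB Require Import structures.
From mathcomp Require Import all_boot all_order all_algebra.
From mathcomp Require Import all_classical all_reals all_analysis.

Set Implicit Arguments.
Unset Strict Implicit.
Unset Printing Implicit Defensive.

Import Order.TTheory GRing.Theory Num.Theory.
Import numFieldNormedType.Exports.

Local Open Scope classical_set_scope.
Local Open Scope ring_scope.

Notation leb1 R := (@lebesgue_measure R).
Notation leb2 R := (product_measure1 (leb1 R) (leb1 R)).
Notation leb3 R := (product_measure1 (leb2 R) (leb1 R)).

Definition unit_square (R : realType) : set (R * R) :=
  `[0, 1]%classic `*` `[0, 1]%classic.

Definition space_time (R : realType) (T : R) : set (R * R * R) :=
  @unit_square R `*` `[0, T]%classic.

(* Indices are 0-based: [cell n i] is the interval Q^n_(i+1); only the
   first one contains its left end point. *)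
Definition cell (R : realType) (n i : nat) : set R :=
  if i == 0%N then `[0, n%:R^-1]%classic
  else `]i%:R / n%:R, i.+1%:R / n%:R]%classic.

Definition step_kernel (R : realType) (n : nat) (b : 'I_n -> 'I_n -> R)
    (z : R * R) : R :=
  \sum_(i < n) \sum_(j < n) b i j * \1_(cell n i `*` cell n j) z.

Definition L1_space_time (R : realType) (T : R) (f : R * R -> R -> R) : Prop :=
  (leb3 R).-integrable (space_time T) (fun z => (f z.1 z.2)%:E).

Definition L1_dist (R : realType) (T : R) (f g : R * R -> R -> R) : \bar R :=
  (\int[leb3 R]_(z in space_time T) (`|f z.1 z.2 - g z.1 z.2|%R)%:E)%E.

Definition bounded_left_continuous (R : realType) (T : R) (f : R -> R) : Prop :=
  (exists M : R, forall t, t \in `[0, T] -> `|f t| <= M) /\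
  (forall t, t \in `]0, T] -> f s @[s --> t^'-] --> f t).

(* The cut distance, as a supremum in the extended reals; it is finite as soon
   as f - g is integrable on the unit square. *)
Definition cut_dist (R : realType) (f g : R * R -> R) : \bar R :=
  ereal_sup [set c : \bar R | exists A B : set R,
    [/\ measurable A, measurable B, A `<=` `[0, 1]%classic,
        B `<=` `[0, 1]%classic
      & c = `| \int[leb2 R]_(z in A `*` B) (f z - g z)%R%:E |%E ] ].

Definition mutually_independent d (Omega : measurableType d) (R : realType)
    (P : probability Omega R) (I : finType) (F : I -> set (set Omega)) : Prop :=
  forall (J : {set I}) (E : I -> set Omega),
    (forall i, i \in J -> F i (E i)) ->
    P (\bigcap_(i in [set` J]) E i) = (\prod_(i in J) P (E i))%E.

(* The sigma-algebra generated by (X u), 0 <= u <= s. *)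
Definition history (Omega : Type) (R : realType) (X : R -> Omega -> bool)
    (s : R) : set (set Omega) :=
  <<s [set X u @^-1` [set y] | u in `[0, s]%classic & y in [set: bool]] >>.

(* Paths in the discrete space bool. *)
Definition cadlag (R : realType) (T : R) (x : R -> bool) : Prop :=
  (forall t, t \in `[0, T[ -> x s @[s --> t^'+] --> x t) /\
  (forall t, t \in `]0, T] -> exists l : bool, x s @[s --> t^'-] --> l).

(* [r u x] is the rate at which the chain jumps, at time u, from x to ~~ x;
   [p s t x y] is the transition probability from (s, x) to (t, y).  The last
   clause is Kolmogorov's forward equation
     d/dt p_(s,t)(x,y) = p_(s,t)(x,~~y) r_t(~~y) - p_(s,t)(x,y) r_t(y),
     p_(s,s)(x,y) = delta_(x,y),
   in integrated form since the rates are only measurable in general. *)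
Definition transition_function (R : realType) (T : R) (r : R -> bool -> R)
    (p : R -> R -> bool -> bool -> R) : Prop :=
  forall s, s \in `[0, T] ->
  [/\ forall t x y, t \in `[s, T] -> 0 <= p s t x y,
      forall t x, t \in `[s, T] -> \sum_(y : bool) p s t x y = 1,
      forall x y, measurable_fun (`[s, T]%classic : set R)
                    (fun t => p s t x y)
    & forall t x y, t \in `[s, T] ->
        p s t x y = (x == y)%:R +
          \int[leb1 R]_(u in `[s, t])
            (p s u x (~~ y) * r u (~~ y) - p s u x y * r u y)].

Definition markov_chain d (Omega : measurableType d) (R : realType)
    (P : probability Omega R) (T : R) (r : R -> bool -> R)
    (X : R -> Omega -> bool) : Prop :=
  [/\ forall t, t \in `[0, T] -> measurable_fun setT (X t),
      forall omega, cadlag T (X ^~ omega)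
    & exists2 p : R -> R -> bool -> bool -> R, transition_function T r p &
        forall s t (A : set Omega) x y, s \in `[0, T] -> t \in `[s, T] ->
          history X s A ->
          P (A `&` X s @^-1` [set x] `&` X t @^-1` [set y]) =
          (P (A `&` X s @^-1` [set x]) * (p s t x y)%:E)%E].

(* Main.v *)
(* Let m be the array of means of the chains. Then d(H_t, w_t) is at most
   d(H_t, m_t) + |m_t - w_t|_1.

   Fixed t: the cut norm of the independent centred array H_t - m_t is a maximum
   over 2 * 4^n vertex-set pairs with signs, so a sum of exponential moments bounds
   d(H_t, m_t) by eps up to an error of expectation 2 * 4^n * exp(- n^2 eps^2 / 8).
   By Tonelli its time integral has a summable expectation, hence tends to 0
   almost surely.

   For the means, put b = betanp + betanm and let phi be w sampled on a time grid of
   K points. Where phi is constant, d/dt (m - phi)^2 = 2 a (m - phi)(betanp - b m),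
   so integrating over [0, T] gives
     int b (m - phi)^2 <= K / (2 a) + int |betanp - b phi|.
   The last integral is controlled by the L^1 distance of the rates and by
   int (betap + betam) |w - phi|, which tends to 0 as K grows, by left continuity and
   dominated convergence. Let n tend to infinity, then K. *)

Require Import Defs.
From HB Require Import structures.
From mathcomp Require Import all_boot all_order all_algebra.
From mathcomp Require Import all_classical all_reals all_analysis.
From mathcomp Require Import measurable_realfun ring lra.

Set Implicit Arguments.
Unset Strict Implicit.
Unset Printing Implicit Defensive.

Import Order.TTheory GRing.Theory Num.Theory.
Import numFieldNormedType.Exports.

Local Open Scope classical_set_scope.
Local Open Scope ring_scope.

(** The limiting total rate [betap + betam] may vanish; there division gives [w = 0] and left
    continuity of [w] can fail. What survives is the identity [(betap + betam) * w = betap]. Hence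
    errors against the limit carry the weight [betap + betam], and the lower bound is taken from the
    discrete rates. The reference [phi] is piecewise constant because [w] has no time derivative to
    set against that of [m]. A jump of [phi] can raise the energy [(m - phi) ^+ 2], which lies in
    [[0, 1]], by at most 1. Each grid interval thus costs at most [1 / (2 * a)], negligible for
    fixed [K] as [a] diverges; this dictates the order of the limits. The means satisfy only an
    integrated equation, so the derivative of the square is replaced by an estimate of increments.
    The union over [4 ^ n] pairs is affordable because the concentration exponent grows like
    [n ^ 2], the number of independent entries. Measurability in time of the cut distance is not
    established; its integral is compared directly with that of a measurable majorant. *)

(** * Monotone integrals and Tonelli on rectangles *)

(** The integral of a nonnegative function is a supremum over simple functions below it, so
    enlarging the function enlarges the family. This is what handles [cut_dist], a supremum over
    uncountably many pairs of sets. *)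
Lemma ge0_le_lower_integral d (T : measurableType d) (R : realType)
    (mu : {measure set T -> \bar R}) (D : set T) (f g : T -> \bar R) :
  (forall x, D x -> (0 <= f x)%E) -> (forall x, D x -> (f x <= g x)%E) ->
  (\int[mu]_(x in D) f x <= \int[mu]_(x in D) g x)%E.
Proof.
move=> f0 fg; have g0 x : D x -> (0 <= g x)%E.
  by move=> Dx; exact: le_trans (f0 _ Dx) (fg _ Dx).
rewrite !ge0_integralE//; apply: ge_ereal_sup => _ [h /= hf <-].
apply: ereal_sup_ubound; exists h => //= x; apply: (le_trans (hf x)).
by rewrite /patch; case: ifP => // /set_mem Dx; exact: fg.
Qed.

(** Extension by zero off the rectangle reduces to Tonelli on the whole product: slices of the
    extension are restricted slices inside and vanish outside. *)
Lemma tonelli_setX d1 d2 (T1 : measurableType d1) (T2 : measurableType d2)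
    (R : realType) (m1 : {sigma_finite_measure set T1 -> \bar R})
    (m2 : {sigma_finite_measure set T2 -> \bar R}) (A : set T1) (B : set T2)
    (f : T1 * T2 -> \bar R) :
  measurable A -> measurable B -> measurable_fun (A `*` B) (fun z => f z) ->
  (forall z, (A `*` B) z -> (0 <= f z)%E) ->
  [/\ measurable_fun A (fun x => \int[m2]_(y in B) f (x, y))%E,
      measurable_fun B (fun y => \int[m1]_(x in A) f (x, y))%E,
      (\int[product_measure1 m1 m2]_(z in A `*` B) f z =
       \int[m1]_(x in A) \int[m2]_(y in B) f (x, y))%E &
      (\int[product_measure1 m1 m2]_(z in A `*` B) f z =
       \int[m2]_(y in B) \int[m1]_(x in A) f (x, y))%E].
Proof.
move=> mA mB mf f0.
have mAB : measurable (A `*` B) by exact: measurableX.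
pose g := f \_ (A `*` B).
have mg : measurable_fun setT g := (measurable_restrictT f mAB).1 mf.
have g0 z : (0 <= g z)%E.
  by rewrite /g /patch; case: ifP => // /set_mem; exact: f0.
have gE1 x : (\int[m2]_y g (x, y) =
    ((fun x => \int[m2]_(y in B) f (x, y)) \_ A) x)%E.
  rewrite /patch; case: ifPn => [/set_mem Ax|/negP xA].
    rewrite [RHS]integral_mkcond; apply: eq_integral => y _.
    rewrite /g /patch; case: (asboolP (B y)) => [By|nBy].
      by rewrite !mem_set.
    by rewrite !memNset// => -[].
  apply: integral0_eq => y _; rewrite /g /patch memNset// => -[/= Ax _].
  by apply: xA; exact/mem_set.
have gE2 y : (\int[m1]_x g (x, y) =
    ((fun y => \int[m1]_(x in A) f (x, y)) \_ B) y)%E.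
  rewrite /patch; case: ifPn => [/set_mem By|/negP yB].
    rewrite [RHS]integral_mkcond; apply: eq_integral => x _.
    rewrite /g /patch; case: (asboolP (A x)) => [Ax|nAx].
      by rewrite !mem_set.
    by rewrite !memNset// => -[].
  apply: integral0_eq => x _; rewrite /g /patch memNset// => -[/= _ By].
  by apply: yB; exact/mem_set.
split.
- apply: (measurable_restrictT _ mA).2.
  have <- : fubini_F m2 g = (fun x => \int[m2]_(y in B) f (x, y))%E \_ A.
    by apply/funext => x; exact: gE1.
  exact: measurable_fun_fubini_tonelli_F.
- apply: (measurable_restrictT _ mB).2.
  have <- : fubini_G m1 g = (fun y => \int[m1]_(x in A) f (x, y))%E \_ B.
    by apply/funext => y; exact: gE2.
  exact: measurable_fun_fubini_tonelli_G.
- rewrite integral_mkcond -/g fubini_tonelli1// [RHS]integral_mkcond.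
  by apply: eq_integral => x _; rewrite /fubini_F gE1.
- rewrite integral_mkcond -/g fubini_tonelli2// [RHS]integral_mkcond.
  by apply: eq_integral => y _; rewrite /fubini_G gE2.
Qed.

Lemma leb2_sigma_finite (R : realType) : sigma_finite setT (leb2 R).
Proof.
pose I (n : nat) : set R := `[- n%:R, n%:R]%classic.
exists (fun n => I n `*` I n).
  rewrite predeqE => -[x y]; split=> // _.
  exists (Num.truncn (Num.max `|x| `|y|)).+1 => //.
  have := truncnS_gt (Num.max `|x| `|y|).
  rewrite gt_max => /andP[hx hy].
  by split; rewrite /I /= in_itv /= -ler_norml ltW.
move=> n; split; first by apply: measurableX; exact: measurable_itv.
have mI : measurable (I n) by exact: measurable_itv.
have hI : (leb1 R (I n) < +oo)%E.
  by rewrite lebesgue_measure_itv; case: ifP => _; rewrite ?ltry.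
rewrite product_measure1E//.
by apply: lte_mul_pinfty => //; rewrite ge0_fin_numE.
Qed.

(* A copy of [leb2] carrying its sigma-finiteness, which is not inferred for
   [product_measure1]. *)
Definition plane_measure (R : realType) := leb2 R.
HB.instance Definition _ (R : realType) := Measure.on (@plane_measure R).
HB.instance Definition _ (R : realType) :=
  Measure_isSigmaFinite.Build _ _ _ (@plane_measure R) (@leb2_sigma_finite R).

Lemma measurable_unit_square (R : realType) : measurable (@unit_square R).
Proof. by apply: measurableX; exact: measurable_itv. Qed.

Lemma tonelli_space_time (R : realType) (T : R) (f : R * R -> R -> R) :
  measurable_fun (space_time T) (fun z => f z.1 z.2) ->
  (forall z t, unit_square z -> t \in `[0, T] -> 0 <= f z t) ->
  [/\ measurable_fun (@unit_square R)
        (fun z => \int[leb1 R]_(t in `[0%R, T]) (f z t)%:E)%E,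
      measurable_fun (`[0, T]%classic : set R)
        (fun t => \int[leb2 R]_(z in @unit_square R) (f z t)%:E)%E,
      (\int[leb3 R]_(z in space_time T) (f z.1 z.2)%:E =
       \int[leb2 R]_(z in @unit_square R) \int[leb1 R]_(t in `[0%R, T]) (f z t)%:E)%E
      & (\int[leb3 R]_(z in space_time T) (f z.1 z.2)%:E =
       \int[leb1 R]_(t in `[0%R, T]) \int[leb2 R]_(z in @unit_square R) (f z t)%:E)%E].
Proof.
move=> mf f0.
have mf' : measurable_fun (@unit_square R `*` `[0, T]%classic)
   (fun z : R * R * R => (f z.1 z.2)%:E) by exact/measurable_EFinP.
have f0' z : (@unit_square R `*` `[0, T]%classic) z -> (0 <= (f z.1 z.2)%:E)%E.
  by move=> [? ?]; rewrite lee_fin; exact: f0.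
have [h0 h0' h1 h2] := tonelli_setX (@plane_measure R) (@lebesgue_measure R)
  (@measurable_unit_square R) (measurable_itv _) mf' f0'.
by split.
Qed.

(** * Cells and cut norms of step kernels *)

(** Scaling by [n] turns cell membership into comparisons with naturals. The strict lower bound asks
    for [0 < i], the first cell being closed on the left. *)
Lemma cell_bounds (R : realType) (n i : nat) (x : R) : (0 < n)%N -> cell n i x ->
  [/\ 0 <= x, i%:R <= x * n%:R, x * n%:R <= i.+1%:R & (0 < i)%N -> i%:R < x * n%:R].
Proof.
move=> n0; rewrite /cell; have n0' : 0 < n%:R :> R by rewrite ltr0n.
case: ifPn => [/eqP ->|i0] /=; rewrite in_itv /=.
  move=> /andP[x0]; rewrite -[n%:R^-1]mul1r ler_pdivlMr// => hx.
  by split => //; exact: mulr_ge0.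
rewrite ltr_pdivrMr// ler_pdivlMr// => /andP[h1 h2]; split => //; last exact: ltW.
by have := le_lt_trans (ler0n R i) h1; rewrite pmulr_lgt0// => /ltW.
Qed.

Lemma cell_inj (R : realType) (n i j : nat) (x : R) : (0 < n)%N ->
  cell n i x -> cell n j x -> i = j.
Proof.
move=> n0 ci cj.
have [_ li ri si] := cell_bounds n0 ci; have [_ lj rj sj] := cell_bounds n0 cj.
have [ij|ji|//] := ltngtP i j.
- have := lt_le_trans (sj (leq_ltn_trans (leq0n _) ij)) ri.
  by rewrite ltr_nat ltnNge ij.
- have := lt_le_trans (si (leq_ltn_trans (leq0n _) ji)) rj.
  by rewrite ltr_nat ltnNge ji.
Qed.

Lemma cell_exists (R : realType) (n : nat) (x : R) : (0 < n)%N -> 0 <= x <= 1 ->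
  exists i : 'I_n, cell n i x.
Proof.
move=> n0 /andP[x0 x1]; have n0' : 0 < n%:R :> R by rewrite ltr0n.
have ex : exists i, x * n%:R <= i.+1%:R.
  by exists n.-1; rewrite prednK// ler_piMl// ltW.
(* The least [i] with [x * n <= i + 1] is the index: minimality supplies the strict left bound when
   [i] is positive. *)
case: (ex_minnP ex) => i hi mi.
have lin : (i < n)%N.
  have : (i <= n.-1)%N by apply: mi; rewrite prednK// ler_piMl// ltW.
  by move=> h; rewrite -(prednK n0) ltnS.
exists (Ordinal lin); rewrite /cell /=; case: ifPn => [/eqP i0|i0] /=; rewrite in_itv /=.
  by move: hi; rewrite x0 -[n%:R^-1]mul1r ler_pdivlMr// i0.
rewrite ltr_pdivrMr// ler_pdivlMr// hi andbT ltNge; apply/negP => h.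
have := mi i.-1; rewrite prednK ?lt0n// => /(_ h).
by rewrite leqNgt prednK ?lt0n// leqnn.
Qed.

Lemma measurable_cell (R : realType) (n i : nat) : measurable (@cell R n i).
Proof. by rewrite /cell; case: ifP => _; exact: measurable_itv. Qed.

Lemma lebesgue_measure_cell (R : realType) (n i : nat) : (0 < n)%N ->
  lebesgue_measure (@cell R n i) = (n%:R^-1)%:E.
Proof.
move=> n0; have n0' : 0 < n%:R :> R by rewrite ltr0n.
rewrite /cell; case: ifP => _; rewrite lebesgue_measure_itv /= lte_fin.
  by rewrite invr_gt0 n0' oppr0 adde0.
rewrite ltr_pM2r ?invr_gt0// ltr_nat ltnSn -EFinB -mulrBl.
by rewrite -natrB// subSnn mul1r.
Qed.

Lemma step_kernelE (R : realType) (n : nat) (b : 'I_n -> 'I_n -> R) (i j : 'I_n) (z : R * R) :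
  (0 < n)%N -> cell n i z.1 -> cell n j z.2 -> step_kernel b z = b i j.
Proof.
move=> n0 ci cj; rewrite /step_kernel (bigD1 i)//= (bigD1 j)//=.
rewrite indicE mem_set// mulr1 !big1 ?addr0//.
- move=> k ki; apply: big1 => l _; rewrite indicE memNset ?mulr0// => -[/= ck _].
  by move/eqP: ki; apply; apply: val_inj; exact: (cell_inj n0 ck ci).
- move=> k kj; rewrite indicE memNset ?mulr0// => -[/= _ ck].
  by move/eqP: kj; apply; apply: val_inj; exact: (cell_inj n0 ck cj).
Qed.

Lemma unit_square_cells (R : realType) (n : nat) (z : R * R) : (0 < n)%N -> unit_square z ->
  exists i j : 'I_n, cell n i z.1 /\ cell n j z.2.
Proof.
move=> n0 [/= h1 h2]; rewrite !in_itv /= in h1 h2.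
have [i ci] := cell_exists n0 h1; have [j cj] := cell_exists n0 h2.
by exists i, j.
Qed.

(** A linear form on a cube is largest at the vertex that keeps exactly the coordinates with
    nonnegative coefficient. *)
Lemma sum_le_positive_part (R : realType) (I : finType) (h : R) (a c : I -> R) :
  0 <= h -> (forall i, 0 <= a i <= h) ->
  \sum_i a i * c i <= h * \sum_(i in [set i | 0 <= c i]%SET) c i.
Proof.
move=> h0 ah; rewrite mulr_sumr [leRHS]big_mkcond /=.
apply: ler_sum => i _; have /andP[a0 a1] := ah i; rewrite inE.
case: ifPn => [c0|]; first exact: ler_wpM2r.
by rewrite -ltNge => /ltW c0; exact: mulr_ge0_le0.
Qed.

(** Maximize in [a] with [b] frozen, which gives [S], then in [b] with [S] frozen: a bilinear form
    on a product of cubes is dominated at a pair of vertices. This is how arbitrary measurable sets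
    reduce to sets of indices. *)
Lemma bilinear_le_subset_sum (R : realType) (n : nat) (h : R) (a b : 'I_n -> R)
    (c : 'I_n -> 'I_n -> R) :
  0 <= h -> (forall i, 0 <= a i <= h) -> (forall i, 0 <= b i <= h) ->
  exists S U : {set 'I_n},
    \sum_i \sum_j a i * b j * c i j <= h ^+ 2 * \sum_(i in S) \sum_(j in U) c i j.
Proof.
move=> h0 ah bh.
pose S := [set i | 0 <= \sum_j b j * c i j]%SET.
pose U := [set j | 0 <= \sum_(i in S) c i j]%SET.
exists S, U.
have -> : \sum_i \sum_j a i * b j * c i j = \sum_i a i * \sum_j b j * c i j.
  by apply: eq_bigr => i _; rewrite mulr_sumr; apply: eq_bigr => j _; rewrite mulrA.
apply: (le_trans (sum_le_positive_part (fun i => \sum_j b j * c i j) h0 ah)).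
rewrite expr2 -mulrA ler_wpM2l//.
rewrite exchange_big /= [in leRHS]exchange_big /=.
have -> : \sum_j \sum_(i in S) b j * c i j = \sum_j b j * \sum_(i in S) c i j.
  by apply: eq_bigr => j _; rewrite mulr_sumr.
exact: sum_le_positive_part.
Qed.

(** A partition function in the sense of statistical mechanics, with inverse temperature [lam]: a
    soft maximum, over a sign and two vertex sets, of the signed cut above the threshold
    [eps * n ^ 2]. Each term is a product over entries, so independence factorizes its
    expectation. *)
Definition cut_partition (R : realType) (lam eps : R) (n : nat) (c : 'I_n -> 'I_n -> R) : R :=
  \sum_(k : bool * {set 'I_n} * {set 'I_n})
    expR (lam * ((-1) ^+ k.1.1 * (\sum_(i in k.1.2) \sum_(j in k.2) c i j) -
                 eps * n%:R ^+ 2)).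

Lemma cut_partition_ge0 (R : realType) (lam eps : R) (n : nat) (c : 'I_n -> 'I_n -> R) :
  0 <= cut_partition lam eps c.
Proof. by apply: sumr_ge0 => ? _; exact: expR_ge0. Qed.

(* The maximum over vertex sets is replaced by the sum of exponentials, since
   [y <= expR (k * y)] as soon as [1 <= k]. *)
Lemma bilinear_le_cut_partition (R : realType) (lam eps : R) (n : nat) (a b : 'I_n -> R)
    (c : 'I_n -> 'I_n -> R) : (0 < n)%N -> 1 <= lam * n%:R ^+ 2 ->
  (forall i, 0 <= a i <= n%:R^-1) -> (forall i, 0 <= b i <= n%:R^-1) ->
  `|\sum_i \sum_j a i * b j * c i j| <= eps + cut_partition lam eps c.
Proof.
move=> n0 hlam ah bh; have n0' : 0 < n%:R :> R by rewrite ltr0n.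
have ih0 : 0 <= n%:R^-1 :> R by rewrite invr_ge0 ltW.
(* [s] records the sign of the form; a negative value is handled by the vertex bound for [- c]. *)
have [s [S [U hs]]] : exists (s : bool) (S U : {set 'I_n}),
    `|\sum_i \sum_j a i * b j * c i j| <=
    n%:R^-1 ^+ 2 * ((-1) ^+ s * \sum_(i in S) \sum_(j in U) c i j).
  have [x0|x0] := leP 0 (\sum_i \sum_j a i * b j * c i j).
    have [S [U h]] := bilinear_le_subset_sum c ih0 ah bh.
    by exists false, S, U; rewrite mul1r ger0_norm.
  have [S [U h]] := bilinear_le_subset_sum (fun i j => - c i j) ih0 ah bh.
  exists true, S, U; rewrite expr1 mulN1r ltr0_norm//.
  rewrite -sumrN; under eq_bigr do rewrite -sumrN.
  rewrite -sumrN [in leRHS](eq_bigr (fun i => \sum_(j in U) - c i j)); last first.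
    by move=> i _; rewrite sumrN.
  apply: le_trans h; apply: ler_sum => i _; apply: ler_sum => j _.
  by rewrite mulrN.
rewrite -lerBlDl; apply: (@le_trans _ _ (expR (lam * ((-1) ^+ s *
    (\sum_(i in S) \sum_(j in U) c i j) - eps * n%:R ^+ 2)))); last first.
  rewrite /cut_partition (bigD1 (s, S, U))//= lerDl.
  by apply: sumr_ge0 => ? _; exact: expR_ge0.
set y := (-1) ^+ s * _ in hs *.
pose t := n%:R^-1 ^+ 2 * y - eps.
have -> : lam * (y - eps * n%:R ^+ 2) = lam * n%:R ^+ 2 * t.
  rewrite /t mulrBr; field.
  by rewrite gt_eqF.
apply: (@le_trans _ _ t); first by rewrite /t lerD2r.
have [t0|t0] := leP 0 t; last by rewrite (le_trans (ltW t0))// expR_ge0.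
apply: le_trans (expR_ge1Dx _); rewrite -[leLHS]add0r lerD// ler_peMl//.
Qed.

Lemma integrable_of_bound d (T : measurableType d) (R : realType)
    (mu : {measure set T -> \bar R}) (D : set T) (f : T -> R) (M : R) :
  measurable D -> (mu D < +oo)%E -> measurable_fun D f ->
  (forall x, D x -> `|f x| <= M) -> mu.-integrable D (fun x => (f x)%:E).
Proof.
move=> mD Doo mf fM; apply: measurable_bounded_integrable => //.
exists M; split; first exact: num_real.
by move=> N MN x Dx; exact: le_trans (fM _ Dx) (ltW MN).
Qed.

Lemma measurable_step_kernel (R : realType) (n : nat) (c : 'I_n -> 'I_n -> R) (D : set (R * R)) :
  measurable_fun D (step_kernel c).
Proof.
apply: measurable_sum => i; apply: measurable_sum => j.
apply: measurable_funM; first exact: measurable_cst.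
by apply: measurable_indic; apply: measurableX; exact: measurable_cell.
Qed.

Lemma step_kernel_norm (R : realType) (n : nat) (c : 'I_n -> 'I_n -> R) (M : R) (z : R * R) :
  0 <= M -> (forall i j, `|c i j| <= M) -> unit_square z -> `|step_kernel c z| <= M.
Proof.
move=> M0 cM Qz; case: n c cM => [|n] c cM.
  by rewrite /step_kernel big_ord0 normr0.
have [i [j [ci cj]]] := unit_square_cells (ltn0Sn n) Qz.
by rewrite (step_kernelE c (ltn0Sn n) ci cj).
Qed.

Lemma leb2_unit_square (R : realType) : leb2 R (@unit_square R) = 1%E.
Proof.
have h : lebesgue_measure (`[0, 1]%classic : set R) = 1%E.
  by rewrite lebesgue_measure_itv /= lte_fin ltr01 oppr0 adde0.
pose I := `[0, 1]%classic : set R.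
transitivity (lebesgue_measure I * lebesgue_measure I)%E; last by rewrite h mule1.
by apply: product_measure1E; exact: measurable_itv.
Qed.

Lemma rectangle_finite (R : realType) (A B : set R) : measurable A -> measurable B ->
  A `<=` `[0, 1]%classic -> B `<=` `[0, 1]%classic -> (leb2 R (A `*` B) < +oo)%E.
Proof.
move=> mA mB A1 B1; apply: (@le_lt_trans _ _ (leb2 R (@unit_square R))).
  apply: le_measure; rewrite ?inE; [exact: measurableX|exact: measurable_unit_square|].
  by move=> z [? ?]; split; [exact: A1|exact: B1].
by rewrite leb2_unit_square ltry.
Qed.

(** [A] and [B] enter only through the mass they put in each cell, at most [1 / n]. The integral
    thus becomes a bilinear form on a product of cubes. *)
Lemma integral_step_kernel (R : realType) (n : nat) (c : 'I_n -> 'I_n -> R) (A B : set R) :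
  measurable A -> measurable B -> A `<=` `[0, 1]%classic -> B `<=` `[0, 1]%classic ->
  (\int[leb2 R]_(z in A `*` B) (step_kernel c z)%:E)%E =
  (\sum_(i < n) \sum_(j < n) fine (lebesgue_measure (A `&` cell n i)) *
      fine (lebesgue_measure (B `&` cell n j)) * c i j)%:E.
Proof.
move=> mA mB A1 B1.
have mAB : measurable (A `*` B : set (measurableTypeR R * measurableTypeR R)).
  exact: measurableX.
have fAB := rectangle_finite mA mB A1 B1.
have mC (i j : 'I_n) : measurable (cell n i `*` cell n j : set (R * R)).
  by apply: measurableX; exact: measurable_cell.
have int1 (i j : 'I_n) : (leb2 R).-integrable (A `*` B)
    (fun z => (\1_(cell n i `*` cell n j) z)%:E).
  apply: (@integrable_of_bound _ _ _ _ _ _ 1) => //; first by apply: measurable_indic; exact: mC.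
  by move=> z _; rewrite indicE; case: (_ \in _); rewrite ?normr1 ?normr0.
have int2 (i j : 'I_n) := integrableZl mAB (c i j) (int1 i j).
have int3 (i : 'I_n) : (leb2 R).-integrable (A `*` B)
    (fun z => \sum_(j < n) (c i j)%:E * (\1_(cell n i `*` cell n j) z)%:E)%E.
  by apply: integrable_sum => // j _; exact: int2.
transitivity (\int[leb2 R]_(z in A `*` B)
   \sum_(i < n) \sum_(j < n) (c i j)%:E * (\1_(cell n i `*` cell n j) z)%:E)%E.
  apply: eq_integral => z _; rewrite /step_kernel -sumEFin; apply: eq_bigr => i _.
  by rewrite -sumEFin; apply: eq_bigr => j _; rewrite EFinM.
rewrite integral_sum// -sumEFin; apply: eq_bigr => i _.
rewrite integral_sum// -sumEFin; apply: eq_bigr => j _.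
rewrite integralZl// integral_indic//; last exact: mC.
have mI (E : set R) (k : nat) : measurable E -> measurable (E `&` cell n k).
  by move=> mE; apply: measurableI => //; exact: measurable_cell.
have -> : (cell n i `*` cell n j) `&` (A `*` B) = (A `&` cell n i) `*` (B `&` cell n j).
  by apply/seteqP; split=> z [[? ?] [? ?]].
have hX : leb2 R ((A `&` cell n i) `*` (B `&` cell n j)) =
    (lebesgue_measure (A `&` cell n i) * lebesgue_measure (B `&` cell n j))%E.
  by apply: product_measure1E; exact: mI.
rewrite [X in (_ * X)%E]hX.
have fin (E : set R) (k : nat) : measurable E -> (0 < n)%N ->
    lebesgue_measure (E `&` cell n k) \is a fin_num.
  move=> mE n0; rewrite ge0_fin_numE//; apply: (@le_lt_trans _ _ (lebesgue_measure (@cell R n k))).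
    apply: le_measure; rewrite ?inE; [exact: mI|exact: measurable_cell|exact: subIsetr].
  by rewrite lebesgue_measure_cell// ltry.
have n0 : (0 < n)%N by rewrite (leq_ltn_trans (leq0n i)).
by rewrite mulrC !EFinM !fineK//; exact: fin.
Qed.

Lemma measure_cell_bounds (R : realType) (n i : nat) (E : set R) : (0 < n)%N -> measurable E ->
  0 <= fine (lebesgue_measure (E `&` cell n i)) <= n%:R^-1.
Proof.
move=> n0 mE; rewrite fine_ge0//= -lee_fin.
have le1 : (lebesgue_measure (E `&` cell n i) <= lebesgue_measure (@cell R n i))%E.
  apply: le_measure; rewrite ?inE; [|exact: measurable_cell|exact: subIsetr].
  by apply: measurableI => //; exact: measurable_cell.
rewrite lebesgue_measure_cell// in le1.
by rewrite fineK// ge0_fin_numE// (le_lt_trans le1)// ltry.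
Qed.

(** The deterministic reduction at a fixed time, with [y] the graph and [q] its means. The
    fluctuation [y - q] is a bilinear form in the cell masses, bounded uniformly in [A] and [B]; the
    bias is bounded by its L^1 norm on the whole square. *)
Lemma cut_dist_step_kernel_le (R : realType) (lam eps : R) (n : nat) (y q : 'I_n -> 'I_n -> R)
    (w : R * R -> R) :
  (0 < n)%N -> 1 <= lam * n%:R ^+ 2 ->
  measurable_fun (@unit_square R) w -> (forall z, unit_square z -> `|w z| <= 1) ->
  (cut_dist (step_kernel y) w <=
   (eps + cut_partition lam eps (fun i j => y i j - q i j)%R)%:E +
   \int[leb2 R]_(z in @unit_square R) (`|step_kernel q z - w z|%R)%:E)%E.
Proof.
move=> n0 hlam mw w1; apply: ge_ereal_sup => _ [A [B [mA mB A1 B1 ->]]].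
have mAB : measurable (A `*` B : set (measurableTypeR R * measurableTypeR R)) by exact: measurableX.
have mQ := @measurable_unit_square R.
have fAB := rectangle_finite mA mB A1 B1.
have ABQ : A `*` B `<=` @unit_square R by move=> z [? ?]; split; [exact: A1|exact: B1].
pose c i j := y i j - q i j.
have bnd (b : 'I_n -> 'I_n -> R) : exists2 M, 0 <= M & forall i j, `|b i j| <= M.
  exists (\sum_i \sum_j `|b i j|) => [|i j]; first by do 2!apply: sumr_ge0 => ? _.
  rewrite (bigD1 i)//= (bigD1 j)//= -addrA lerDl addr_ge0// ?sumr_ge0// => ? _.
  by rewrite sumr_ge0.
have [M1 M10 hM1] := bnd c; have [M2 M20 hM2] := bnd q.
have i1 : (leb2 R).-integrable (A `*` B) (fun z => (step_kernel c z)%:E).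
  apply: (@integrable_of_bound _ _ _ _ _ _ M1) => //; first exact: measurable_step_kernel.
  by move=> z /ABQ; exact: step_kernel_norm.
have mqw : measurable_fun (@unit_square R) (fun z => step_kernel q z - w z).
  by apply: measurable_funB => //; exact: measurable_step_kernel.
have i2 : (leb2 R).-integrable (A `*` B) (fun z => (step_kernel q z - w z)%:E).
  apply: (@integrable_of_bound _ _ _ _ _ _ (M2 + 1)) => //.
    exact: measurable_funS mqw.
  move=> z /ABQ Qz; apply: (le_trans (ler_normB _ _)); apply: lerD; last exact: w1.
  exact: step_kernel_norm.
rewrite (_ : (\int[leb2 R]_(z in A `*` B) (step_kernel y z - w z)%:E)%E =
  (\int[leb2 R]_(z in A `*` B) (step_kernel c z)%:E +
   \int[leb2 R]_(z in A `*` B) (step_kernel q z - w z)%:E)%E); last first.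
  rewrite -integralD//; apply: eq_integral => z _; rewrite -EFinD; congr EFin.
  rewrite addrA; congr (_ - _); rewrite /step_kernel -big_split; apply: eq_bigr => i _ /=.
  by rewrite -big_split; apply: eq_bigr => j _ /=; rewrite -mulrDl subrK.
apply: (le_trans (lee_abs_add _ _)); apply: leeD.
  rewrite integral_step_kernel// lee_fin; apply: bilinear_le_cut_partition => // i;
  exact: measure_cell_bounds.
apply: (@le_trans _ _ (\int[leb2 R]_(z in A `*` B) (`|step_kernel q z - w z|%R)%:E)%E).
  by apply: le_abse_integral => //; apply/measurable_EFinP; exact: measurable_funS mqw.
apply: ge0_subset_integral => //.
by apply/measurable_EFinP; exact: measurableT_comp.
Qed.

(** * Exponential moments of an independent array *)

(** From [1 - x <= expR (- x)] one gets [expR x <= 1 / (1 - x)], and [(1 - x) * (1 + x + 2 * x ^+ 2)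
    - 1 = x ^+ 2 * (1 - 2 * x)]. *)
Lemma expR_le_quadratic (R : realType) (x : R) : x <= 2^-1 -> expR x <= 1 + x + 2 * x ^+ 2.
Proof.
move=> hx; have x1 : 0 < 1 - x by lra.
have : expR x <= (1 - x)^-1.
  rewrite -[expR x]invrK lef_pV2 ?posrE ?invr_gt0 ?expR_gt0//.
  by rewrite -expRN; exact: expR_ge1Dx.
move=> /le_trans; apply; rewrite -[leLHS]mul1r ler_pdivrMr//.
rewrite -subr_ge0 (_ : _ - 1 = x ^+ 2 * (1 - 2 * x)); last by ring.
by apply: mulr_ge0; [exact: sqr_ge0|lra].
Qed.

(** Centring cancels the linear terms, and the quadratic ones add up to [2 * l ^+ 2] times the
    variance [p * (1 - p)], which is at most 1. The constant is cruder than Hoeffding's. *)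
Lemma bernoulli_mgf (R : realType) (p l : R) : 0 <= p <= 1 -> `|l| <= 2^-1 ->
  (1 - p) * expR (l * (0 - p)) + p * expR (l * (1 - p)) <= expR (2 * l ^+ 2).
Proof.
move=> /andP[p0 p1] hl; apply: le_trans (expR_ge1Dx _).
have small (u : R) : `|u| <= 1 -> l * u <= 2^-1.
  move=> u1; apply: (le_trans (ler_norm _)); rewrite normrM -[leRHS]mulr1.
  exact: ler_pM.
have h1 : expR (l * (0 - p)) <= 1 + l * (0 - p) + 2 * (l * (0 - p)) ^+ 2.
  by apply: expR_le_quadratic; apply: small; rewrite sub0r normrN ger0_norm.
have h2 : expR (l * (1 - p)) <= 1 + l * (1 - p) + 2 * (l * (1 - p)) ^+ 2.
  by apply: expR_le_quadratic; apply: small; rewrite ger0_norm; lra.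
have p1' : 0 <= 1 - p by rewrite subr_ge0.
apply: (le_trans (lerD (ler_wpM2l p1' h1) (ler_wpM2l p0 h2))).
rewrite -subr_ge0 (_ : _ - _ = l ^+ 2 * (2 - 2 * p * (1 - p))); last by ring.
apply: mulr_ge0; first exact: sqr_ge0.
by rewrite subr_ge0 -mulrA ler_piMr// mulr_ile1// lerBlDr lerDl.
Qed.

(** Exactly one configuration [y] occurs at each point, so the product is a finite combination of
    indicators of configurations. Independence evaluates each of them, and distributivity of product
    over sum regroups the result. *)
Lemma expectation_prod_bool d (Omega : measurableType d) (R : realType)
    (P : probability Omega R) (I : finType) (B : I -> Omega -> bool) (f : I -> bool -> R) :
  (forall i, measurable_fun setT (B i)) ->
  (forall y : I -> bool, P (\bigcap_(i in [set: I]) B i @^-1` [set y i]) =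
     (\prod_i P (B i @^-1` [set y i]))%E) ->
  (forall i b, 0 <= f i b) ->
  (\int[P]_w (\prod_i f i (B i w))%:E =
   (\prod_i \sum_b f i b * fine (P (B i @^-1` [set b])))%:E)%E.
Proof.
move=> mB PB f0.
pose E (y : {ffun I -> bool}) := \bigcap_(i in [set: I]) B i @^-1` [set y i].
have mBi i b : measurable (B i @^-1` [set b]).
  by rewrite -[_ @^-1` _]setTI; exact: mB.
have mE y : measurable (E y).
  by apply: fin_bigcap_measurable => // i _; exact: mBi.
transitivity (\int[P]_w \sum_(y : {ffun I -> bool})
    (\prod_i f i (y i) * \1_(E y) w)%:E)%E.
  apply: eq_integral => w _; pose y0 := [ffun i => B i w].
  rewrite (bigD1 y0)//= [X in (_ + X)%E]big1 ?adde0; last first.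
    move=> y yy0; rewrite indicE memNset/= ?mulr0// => Ey; move/eqP: yy0; apply.
    by apply/ffunP => i; rewrite ffunE (Ey i).
  rewrite indicE mem_set/=; last by move=> i _; rewrite /= ffunE.
  by rewrite mulr1; congr EFin; apply: eq_bigr => i _; rewrite ffunE.
have fy0 (y : {ffun I -> bool}) : 0 <= \prod_i f i (y i) by exact: prodr_ge0.
rewrite ge0_integral_sum//; last 2 first.
- move=> y; apply/measurable_EFinP; apply: measurable_funM; first exact: measurable_cst.
  by apply: measurable_indic; exact: mE.
- by move=> y w _; rewrite lee_fin mulr_ge0// indicE.
rewrite bigA_distr_bigA -sumEFin; apply: eq_bigr => y _.
under eq_integral do rewrite EFinM.
rewrite integralZl//; last first.
  apply: integrable_indic; exact: mE.
rewrite integral_indic// setIT.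
rewrite [X in (_ * X)%E](PB y) big_split /= EFinM; congr (_ * _)%E.
rewrite -prodEFin; apply: eq_bigr => i _; rewrite fineK//.
by rewrite fin_num_measure.
Qed.

(** There are [2 * 4 ^+ n] exponentials. Each factorizes over the [n ^ 2] independent entries, with
    factors of mean at most [expR (2 * lam ^+ 2)]; the threshold contributes the exponent
    [- lam * eps * n ^ 2]. *)
Lemma expectation_cut_partition d (Omega : measurableType d) (R : realType)
    (P : probability Omega R) (n : nat) (B : 'I_n -> 'I_n -> Omega -> bool)
    (q : 'I_n -> 'I_n -> R) (lam eps : R) :
  (forall i j, measurable_fun setT (B i j)) ->
  (forall y : 'I_n * 'I_n -> bool,
     P (\bigcap_(ij in [set: 'I_n * 'I_n]) B ij.1 ij.2 @^-1` [set y ij]) =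
     (\prod_ij P (B ij.1 ij.2 @^-1` [set y ij]))%E) ->
  (forall i j, P (B i j @^-1` [set true]) = (q i j)%:E) ->
  0 <= lam <= 2^-1 ->
  (\int[P]_w (cut_partition lam eps (fun i j => (B i j w)%:R - q i j)%R)%:E <=
   (2 * 4 ^+ n * expR (n%:R ^+ 2 * (2 * lam ^+ 2 - lam * eps)))%:E)%E.
Proof.
move=> mB PB Pq /andP[lam0 lam1].
have mBi i j b : measurable (B i j @^-1` [set b]).
  by rewrite -[_ @^-1` _]setTI; exact: mB.
have Pq0 i j : P (B i j @^-1` [set false]) = (1 - q i j)%:E.
  rewrite (_ : _ @^-1` _ = ~` (B i j @^-1` [set true])); last first.
    by apply/seteqP; split => w /=; case: (B i j w).
  by rewrite probability_setC// Pq.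
have q01 i j : 0 <= q i j <= 1.
  rewrite -lee_fin -Pq measure_ge0/= -lee_fin -Pq.
  exact: probability_le1.
pose l (s : bool) : R := lam * (-1) ^+ s.
have hl s : `|l s| <= 2^-1.
  by rewrite /l normrM normrX normrN1 expr1n mulr1 ger0_norm.
have hl2 s : l s ^+ 2 = lam ^+ 2 by rewrite /l exprMn -exprM mulnC exprM sqrrN expr1n expr1n mulr1.
(* The factor 1 off the chosen pair of sets lets every term be a product over all entries. *)
pose g s (S U : {set 'I_n}) (ij : 'I_n * 'I_n) (b : bool) : R :=
  if (ij.1 \in S) && (ij.2 \in U) then expR (l s * (b%:R - q ij.1 ij.2)) else 1.
have g0 s S U ij b : 0 <= g s S U ij b.
  by rewrite /g; case: ifP => _ //; exact: expR_ge0.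
have termE (s : bool) (S U : {set 'I_n}) w : expR (lam * ((-1) ^+ s *
     (\sum_(i in S) \sum_(j in U) ((B i j w)%:R - q i j)) - eps * n%:R ^+ 2)) =
   expR (- (lam * eps * n%:R ^+ 2)) * \prod_ij g s S U ij (B ij.1 ij.2 w).
  rewrite mulrBr expRB mulrC !mulrA -expRN; congr (_ * _).
  rewrite -/(l s) pair_big_dep /= mulr_sumr expR_sum big_mkcond /=.
  by apply: eq_bigr => -[i j] _ /=; rewrite /g /=.
have mterm s S U : measurable_fun setT (fun w =>
    (\prod_ij g s S U ij (B ij.1 ij.2 w))%:E).
  apply/measurable_EFinP; apply: measurable_prod => ij _.
  by apply: (measurableT_comp (f := g s S U ij)) => //; exact: mB.
have intterm s S U : (\int[P]_w (\prod_ij g s S U ij (B ij.1 ij.2 w))%:E <=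
    (expR (n%:R ^+ 2 * (2 * lam ^+ 2)))%:E)%E.
  rewrite (expectation_prod_bool (fun ij => mB ij.1 ij.2) PB (g0 s S U)).
  rewrite lee_fin (_ : n%:R ^+ 2 * (2 * lam ^+ 2) =
     \sum_(ij : 'I_n * 'I_n) 2 * lam ^+ 2); last first.
    by rewrite sumr_const card_prod card_ord -[RHS]mulr_natl natrM expr2.
  rewrite expR_sum; apply: ler_prod => -[i j] _ /=.
  rewrite sumr_ge0/=; last first.
    by move=> b _; apply: mulr_ge0 => //; exact: fine_ge0.
  rewrite big_bool /= Pq Pq0 /= /g /=; case: ifP => _.
    by rewrite addrC mulrC [X in _ + X]mulrC -(hl2 s); exact: bernoulli_mgf.
  (* An idle entry has mean 1, enlarged so that the bound is the same for all pairs of sets. *)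
  rewrite !mul1r addrCA subrr addr0; apply: (le_trans _ (expR_ge1Dx _)).
  by rewrite lerDl mulr_ge0// sqr_ge0.
rewrite /cut_partition.
under eq_integral => w _.
  under eq_bigr do rewrite termE.
  rewrite -sumEFin; under eq_bigr do rewrite EFinM.
  over.
rewrite ge0_integral_sum//; last 2 first.
- by move=> [[s S] U] /=; apply: measurable_funeM; exact: mterm.
- move=> k w _; apply: mule_ge0; rewrite lee_fin ?expR_ge0//.
  by apply: prodr_ge0 => ij _; exact: g0.
apply: (@le_trans _ _ (\sum_(k : bool * {set 'I_n} * {set 'I_n})
   (expR (n%:R ^+ 2 * (2 * lam ^+ 2 - lam * eps)))%:E)%E).
  apply: lee_sum => -[[s S] U] _ /=.
  rewrite ge0_integralZl//; last first.
    by move=> w _; rewrite lee_fin; apply: prodr_ge0 => ij _; exact: g0.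
  apply: (le_trans (lee_wpmul2l _ (intterm s S U))); first by rewrite lee_fin expR_ge0.
  rewrite -EFinM lee_fin -expRD ler_expR le_eqVlt; apply/orP; left; apply/eqP.
  by ring.
have cardS : #|{set 'I_n}| = (2 ^ n)%N.
  by rewrite -cardsT -powersetT card_powerset cardsT card_ord.
rewrite sumEFin lee_fin sumr_const card_prod card_prod card_bool cardS.
rewrite -[leLHS]mulr_natl ler_wpM2r ?expR_ge0// !natrM !natrX -mulrA -exprMn.
by rewrite -natrM.
Qed.

(** * The energy estimate for the forward equation *)

(** Cutting into [N + 1] equal steps bounds the total increment by [C * (b - a) ^+ 2 / (N + 1)], for
    every [N]. It stands in for the vanishing of a derivative. *)
Lemma eq_of_quadratic_increments (R : realType) (F : R -> R) (a b C : R) : a <= b ->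
  (forall u v, a <= u -> u <= v -> v <= b -> `|F v - F u| <= C * (v - u) ^+ 2) -> F b = F a.
Proof.
move=> ab hF.
have step (N : nat) : `|F b - F a| <= C * (b - a) ^+ 2 / N.+1%:R.
  have N0 : 0 < N.+1%:R :> R by rewrite ltr0n.
  pose p (k : nat) := a + (b - a) * k%:R / N.+1%:R.
  have pS k : p k.+1 - p k = (b - a) / N.+1%:R.
    by rewrite /p -natr1; field; rewrite gt_eqF.
  have -> : F b - F a = \sum_(0 <= k < N.+1) (F (p k.+1) - F (p k)).
    rewrite telescope_sumr// /p mulr0 mul0r addr0; congr (F _ - _).
    by field; rewrite gt_eqF.
  rewrite big_mkord; apply: (le_trans (ler_norm_sum _ _ _)).
  apply: (@le_trans _ _ (\sum_(k < N.+1) C * ((b - a) / N.+1%:R) ^+ 2)).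
    apply: ler_sum => k _; rewrite -(pS k); apply: hF.
    - by rewrite /p lerDl mulr_ge0// ?mulr_ge0 ?subr_ge0// invr_ge0 ltW.
    - by rewrite -subr_ge0 pS mulr_ge0 ?subr_ge0// invr_ge0 ltW.
    - rewrite /p -lerBrDl ler_pdivrMr// ler_wpM2l ?subr_ge0// ler_nat.
      exact: ltn_ord.
  rewrite sumr_const card_ord -[leLHS]mulr_natl le_eqVlt; apply/orP; left; apply/eqP.
  by field; rewrite gt_eqF.
apply/eqP; rewrite -subr_eq0 -normr_le0; apply/ler_addgt0Pr => e e0; rewrite add0r.
pose D := C * (b - a) ^+ 2.
have [N hN] : exists N : nat, D / e <= N.+1%:R.
  exists (Num.truncn (D / e)); exact: ltW (truncnS_gt _).
apply: (le_trans (step N)); rewrite ler_pdivrMr ?ltr0n// -/D.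
by rewrite mulrC -ler_pdivrMr.
Qed.

(* [measurable_itv] lives in the default display of [R], [lebesgue_measure] in
   the one of [measurableTypeR R]. *)
Lemma measurable_itvR (R : realType) (i : interval R) :
  measurable ([set` i] : set (measurableTypeR R)).
Proof. exact: measurable_itv. Qed.

Section integrated_rate.
Context {R : realType} (T M x0 : R) (x g : R -> R).
Notation mu := (@lebesgue_measure R).
Hypothesis T0 : 0 < T.
Hypothesis mg : measurable_fun (`[0, T]%classic : set R) g.
Hypothesis gM : forall t, t \in `[0, T] -> `|g t| <= M.
Hypothesis mx : measurable_fun (`[0, T]%classic : set R) x.
Hypothesis x01 : forall t, t \in `[0, T] -> 0 <= x t <= 1.
Hypothesis xE : forall t, t \in `[0, T] -> x t = x0 + \int[mu]_(u in `[0, t]) g u.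

Let integrable_sub (f : R -> R) (L : R) (i : interval R) :
  measurable_fun (`[0, T]%classic : set R) f -> (forall t, t \in `[0, T] -> `|f t| <= L) ->
  [set` i] `<=` `[0, T]%classic -> mu.-integrable [set` i] (EFin \o f).
Proof.
move=> mf fL iT.
have iT0 : mu.-integrable `[0, T]%classic (EFin \o f).
  apply: (@integrable_of_bound _ _ _ _ _ _ L) => //.
  by rewrite /= lebesgue_measure_itv; case: ifP; rewrite ltry.
exact: (integrableS (measurable_itvR _) (measurable_itvR _) iT iT0).
Qed.

Let increment (f : R -> R) (L : R) (u v : R) :
  measurable_fun (`[0, T]%classic : set R) f -> (forall t, t \in `[0, T] -> `|f t| <= L) ->
  0 <= u -> u <= v -> v <= T ->
  \int[mu]_(t in `[0, v]) f t - \int[mu]_(t in `[0, u]) f t = \int[mu]_(t in `]u, v]) f t.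
Proof.
move=> mf fL u0 uv vT; apply: Rintegral_itvB => //; rewrite ?bnd_simp//.
apply: (integrable_sub mf fL); apply: subset_itvl; by rewrite bnd_simp.
Qed.

Let sub_oc (u v : R) : 0 <= u -> v <= T -> `]u, v]%classic `<=` (`[0, T]%classic : set R).
Proof.
move=> u0 vT t /=; rewrite !in_itv /= => /andP[ut tv].
by rewrite (le_trans u0 (ltW ut)) (le_trans tv vT).
Qed.

Let bound (f : R -> R) (L u v : R) :
  measurable_fun (`[0, T]%classic : set R) f ->
  0 <= u -> u <= v -> v <= T -> (forall t, t \in `]u, v] -> `|f t| <= L) ->
  `|\int[mu]_(t in `]u, v]) f t| <= L * (v - u).
Proof.
move=> mf u0 uv vT fL.
have fin : (mu `]u, v]%classic < +oo)%E by rewrite lebesgue_measure_itv /=; case: ifP; rewrite ltry.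
have mf' : measurable_fun (`]u, v]%classic : set R) f.
  by apply: measurable_funS mf => //; exact: sub_oc.
have intf : mu.-integrable `]u, v]%classic (EFin \o f).
  exact: (@integrable_of_bound _ _ _ _ _ _ L).
apply: (le_trans (le_normr_Rintegral _ intf)) => //.
apply: (@le_trans _ _ (\int[mu]_(t in `]u, v]) L)).
  apply: le_Rintegral => //.
  - by apply: (@integrable_of_bound _ _ _ _ _ _ L) => //; [exact: measurableT_comp|
      move=> t /fL; rewrite normr_id].
  - by apply: (@integrable_of_bound _ _ _ _ _ _ `|L|) => //.
rewrite Rintegral_cst//= lebesgue_measure_itv /= lte_fin.
by case: ltgtP uv => [uv||->] _ //=; rewrite subrr.
Qed.

(** The chain rule for [(x - c) ^+ 2] in integrated form, where [x] is merely the primitive of a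
    bounded measurable [g]. *)
Lemma integrated_rate_sqr (c s t : R) : 0 <= c <= 1 -> 0 <= s -> s <= t -> t <= T ->
  (x t - c) ^+ 2 - (x s - c) ^+ 2 = 2 * \int[mu]_(u in `]s, t]) ((x u - c) * g u).
Proof.
move=> /andP[c0 c1] s0 st tT.
have inT u : 0 <= u -> u <= T -> u \in `[0, T] by move=> ? ?; rewrite in_itv /=; apply/andP.
have M0 : 0 <= M by rewrite (le_trans _ (gM (inT _ s0 (le_trans st tT)))).
pose f u := (x u - c) * g u.
have mf : measurable_fun (`[0, T]%classic : set R) f.
  by apply: measurable_funM => //; apply: measurable_funB => //; exact: measurable_cst.
have xc1 u : u \in `[0, T] -> `|x u - c| <= 1.
  by move=> /x01 /andP[? ?]; rewrite ler_norml; lra.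
have fM u : u \in `[0, T] -> `|f u| <= M.
  by move=> uT; rewrite normrM -[M]mul1r ler_pM// ?xc1 ?gM.
have dx u v : 0 <= u -> u <= v -> v <= T -> x v - x u = \int[mu]_(r in `]u, v]) g r.
  move=> u0 uv vT; rewrite (xE (inT v (le_trans u0 uv) vT)) (xE (inT u u0 (le_trans uv vT))).
  by rewrite -(increment mg gM u0 uv vT); ring.
have lip u v : 0 <= u -> u <= v -> v <= T -> `|x v - x u| <= M * (v - u).
  move=> u0 uv vT; rewrite dx//; apply: bound => // r ruv; apply: gM.
  exact: (sub_oc u0 vT).
pose F v := (x v - c) ^+ 2 - 2 * \int[mu]_(u in `[0, v]) f u.
suff h : F t = F s.
  rewrite -(increment mf fM s0 st tT).
  have -> : (x t - c) ^+ 2 = F t + 2 * \int[mu]_(u in `[0, t]) f u by rewrite /F subrK.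
  have -> : (x s - c) ^+ 2 = F s + 2 * \int[mu]_(u in `[0, s]) f u by rewrite /F subrK.
  by rewrite h opprD addrACA subrr add0r mulrBr.
(* The increment of [F] is [(x v - x u) ^+ 2] minus twice the integral of [(x r - x u) * g r]. As
   [x] is [M]-Lipschitz, these are at most [M ^+ 2 * (v - u) ^+ 2] and twice that, whence the 3. *)
apply: (@eq_of_quadratic_increments _ F s t (3 * M ^+ 2)) => // u v su uv vt.
have u0 := le_trans s0 su; have vT := le_trans vt tT.
have uT := le_trans uv vT.
pose e r := (x r - x u) * g r.
have me : measurable_fun (`[0, T]%classic : set R) e.
  by apply: measurable_funM => //; apply: measurable_funB => //; exact: measurable_cst.
have -> : F v - F u = (x v - x u) ^+ 2 - 2 * \int[mu]_(r in `]u, v]) e r.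
  have ig : mu.-integrable `]u, v]%classic (EFin \o g).
    by apply: (integrable_sub mg gM); exact: sub_oc.
  have ie : mu.-integrable `]u, v]%classic (EFin \o e).
    apply: (integrable_sub (L := M)) => //; last exact: sub_oc.
    move=> r rT; rewrite normrM -[M]mul1r ler_pM// ?gM// ler_norml.
    have /andP[? ?] := x01 rT; have /andP[? ?] := x01 (inT u u0 uT); lra.
  have : \int[mu]_(r in `]u, v]) f r =
      (x u - c) * \int[mu]_(r in `]u, v]) g r + \int[mu]_(r in `]u, v]) e r.
    rewrite -RintegralZl// -RintegralD//; last first.
      exact: (integrableZl _ (x u - c) ig).
    by apply: eq_Rintegral => r _; rewrite /f /e; ring.
  rewrite -(increment mf fM u0 uv vT) -(dx _ _ u0 uv vT) => h.
  have -> : F v - F u = (x v - c) ^+ 2 - (x u - c) ^+ 2 -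
     2 * (\int[mu]_(u in `[0, v]) f u - \int[mu]_(u in `[0, u]) f u) by rewrite /F; ring.
  by rewrite h; ring.
apply: (le_trans (ler_normB _ _)).
have -> : 3 * M ^+ 2 * (v - u) ^+ 2 = (M * (v - u)) ^+ 2 + 2 * (M * (v - u) * M * (v - u)) by ring.
apply: lerD; first by rewrite normrX ler_pXn2r ?nnegrE ?mulr_ge0 ?subr_ge0// lip.
rewrite normrM ger0_norm// ler_wpM2l//; apply: bound => // r.
rewrite in_itv /= => /andP[ur rv]; rewrite normrM ler_pM// ?gM ?inT ?(le_trans rv)//.
- by rewrite (le_trans (lip _ _ u0 (ltW ur) (le_trans rv vT)))// ler_wpM2l// lerB.
- by rewrite (le_trans u0)// ltW.
Qed.

(** On one grid interval the integral of [h] is at most half the loss of the energy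
    [(x - c k) ^+ 2], which stays in [[0, 1]]. The target changes between intervals, so the energies
    do not telescope and each interval costs up to 1/2. *)
Lemma integrated_rate_energy (K : nat) (c : nat -> R) (h : R -> R) : (0 < K)%N ->
  (forall k, 0 <= c k <= 1) ->
  mu.-integrable `[0, T]%classic (EFin \o h) ->
  (forall k t, (k < K)%N -> t \in `[0, T] -> cell K k (t / T) -> h t <= - ((x t - c k) * g t)) ->
  \int[mu]_(t in `[0, T]) h t <= K%:R / 2.
Proof.
move=> K0 c01 ih hle; have K0' : 0 < K%:R :> R by rewrite ltr0n.
pose p (k : nat) := T * k%:R / K%:R.
have p0 k : 0 <= p k by rewrite /p !mulr_ge0// ?invr_ge0// ltW.
have pK : p K = T by rewrite /p mulfK// gt_eqF.
have pS k : p k <= p k.+1.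
  by rewrite /p ler_wpM2r ?invr_ge0 ?(ltW K0')// ler_wpM2l ?(ltW T0)// ler_nat.
have pT k : (k <= K)%N -> p k <= T.
  move=> kK; rewrite -[leRHS]pK /p ler_wpM2r ?invr_ge0 ?(ltW K0')//.
  by rewrite ler_wpM2l ?(ltW T0)// ler_nat.
suff H k : (k <= K)%N -> \int[mu]_(t in `[0, p k]) h t <= k%:R / 2.
  by rewrite -[X in `[0, X]]pK; exact: H.
elim: k => [_|k IH kK].
  by rewrite /p mulr0 mul0r set_itv1 Rintegral_set1 mul0r.
have ihk (i : interval R) : [set` i] `<=` (`[0, T]%classic : set R) ->
    mu.-integrable [set` i] (EFin \o h).
  by move=> iT; exact: (integrableS (measurable_itvR _) (measurable_itvR _) iT ih).
have E : \int[mu]_(t in `[0, p k.+1]) h t - \int[mu]_(t in `[0, p k]) h t =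
    \int[mu]_(t in `]p k, p k.+1]) h t.
  apply: Rintegral_itvB; rewrite ?bnd_simp//.
  by apply: ihk; apply: subset_itvl; rewrite bnd_simp pT.
rewrite -(subrK (\int[mu]_(t in `[0, p k]) h t) (\int[mu]_(t in `[0, p k.+1]) h t)) E.
rewrite -natr1 mulrDl addrC; apply: lerD; first exact: IH (ltnW kK).
pose f u := (x u - c k) * g u.
have mf : measurable_fun (`[0, T]%classic : set R) (fun u => - f u).
  apply: measurableT_comp => //.
  by apply: measurable_funM => //; apply: measurable_funB => //; exact: measurable_cst.
have fM u : u \in `[0, T] -> `|- f u| <= M.
  move=> uT; rewrite normrN normrM -[M]mul1r ler_pM// ?gM// ler_norml.
  have /andP[? ?] := x01 uT; have /andP[? ?] := c01 k; lra.
have iS : `]p k, p k.+1]%classic `<=` (`[0, T]%classic : set R) by apply: sub_oc => //; exact: pT.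
have inf : mu.-integrable `]p k, p k.+1]%classic (EFin \o (fun u => - f u)).
  exact: (integrable_sub mf fM iS).
apply: (@le_trans _ _ (\int[mu]_(t in `]p k, p k.+1]) (- f t))).
  apply: le_Rintegral => //; first exact: ihk.
  move=> t tk; apply: hle => //; first exact: iS.
  move: tk => /=; rewrite in_itv /= => /andP[t1 t2].
  have e1 : k%:R / K%:R < t / T.
    by rewrite ltr_pdivlMr// mulrC mulrA; exact: t1.
  have e2 : t / T <= k.+1%:R / K%:R.
    by rewrite ler_pdivrMr// mulrC mulrA; exact: t2.
  rewrite /cell; case: ifPn => [/eqP k0|_] /=; rewrite in_itv /=.
    apply/andP; split; first by rewrite divr_ge0 ?(ltW T0)// (le_trans (p0 k))// ltW.
    by rewrite (le_trans e2)// k0 mul1r.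
  by rewrite e1 e2.
have -> : \int[mu]_(t in `]p k, p k.+1]) (- f t) = - \int[mu]_(t in `]p k, p k.+1]) f t.
  rewrite -mulN1r -RintegralZl//; last first.
    have := integrableN inf.
    by apply: eq_integrable => // u _ /=; rewrite opprK.
  by apply: eq_Rintegral => u _; rewrite mulN1r.
have := integrated_rate_sqr (c01 k) (p0 k) (pS k) (pT _ kK); rewrite -/f => e.
have b1 : (x (p k) - c k) ^+ 2 <= 1.
  have /x01/andP[? ?] : p k \in `[0, T] by rewrite in_itv /= p0 pT// ltnW.
  have /andP[? ?] := c01 k; rewrite -subr_ge0.
  rewrite (_ : 1 - _ = (1 - (x (p k) - c k)) * (1 + (x (p k) - c k))); last by ring.
  by apply: mulr_ge0; lra.
have b2 := sqr_ge0 (x (p k.+1) - c k).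
have e' : (x (p k.+1) - c k) ^+ 2 - (x (p k) - c k) ^+ 2 =
  2 * \int[mu]_(t in `]p k, p k.+1]) f t by [].
lra.
Qed.

End integrated_rate.

(** * Measurable slices and piecewise constant sampling in time *)

Section product_slices.
Context d1 d2 d3 (T1 : measurableType d1) (T2 : measurableType d2) (T3 : measurableType d3).
Variables (A : set T1) (B : set T2).
Hypotheses (mA : measurable A) (mB : measurable B).

Lemma measurable_comp_fst (f : T1 -> T3) :
  measurable_fun A f -> measurable_fun (A `*` B) (fun z : T1 * T2 => f z.1).
Proof.
move=> mf; apply: (measurable_comp mA) mf _; first by move=> _ [z [? ?] <-].
exact: measurable_funTS measurable_fst.
Qed.

Lemma measurable_comp_snd (f : T2 -> T3) :
  measurable_fun B f -> measurable_fun (A `*` B) (fun z : T1 * T2 => f z.2).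
Proof.
move=> mf; apply: (measurable_comp mB) mf _; first by move=> _ [z [? ?] <-].
exact: measurable_funTS measurable_snd.
Qed.

Lemma measurable_slice1 (f : T1 -> T2 -> T3) (y : T2) :
  measurable_fun (A `*` B) (fun z => f z.1 z.2) -> B y -> measurable_fun A (f ^~ y).
Proof.
move=> mf By; apply: (measurable_comp (measurableX mA mB) _ mf (g := pair^~ y)).
  by move=> _ [x Ax <-].
exact: measurable_funTS (pair2_measurable y).
Qed.

Lemma measurable_slice2 (f : T1 -> T2 -> T3) (x : T1) :
  measurable_fun (A `*` B) (fun z => f z.1 z.2) -> A x -> measurable_fun B (f x).
Proof.
move=> mf Ax; apply: (measurable_comp (measurableX mA mB) _ mf (g := pair x)).
  by move=> _ [y By <-].
exact: measurable_funTS (pair1_measurable x).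
Qed.

End product_slices.

(** The inverse agrees with the power of exponent -1 on nonnegative reals, 0 included, and that
    power is measurable. *)
Lemma measurable_fun_div d (T : measurableType d) (R : realType) (D : set T) (f g : T -> R) :
  measurable D -> measurable_fun D f -> measurable_fun D g -> (forall x, D x -> 0 <= g x) ->
  measurable_fun D (fun x => f x / g x).
Proof.
move=> mD mf mg g0; apply: measurable_funM => //.
apply: (eq_measurable_fun (fun x => g x `^ (-1))).
  by move=> x /set_mem Dx; rewrite powR_inv1// g0.
exact: (measurableT_comp (measurable_powR (-1)) mg).
Qed.

(** The spatial cells are reused for the time grid after rescaling by [T]. Writing a sum of weights
    keeps measurability evident when [c] depends on a further variable. *)
Definition sampled (R : realType) (T : R) (K : nat) (c : nat -> R) (t : R) : R :=
  \sum_(k < K) \1_(cell K k) (t / T) * c k.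

Lemma sampledE (R : realType) (T : R) (K k : nat) (c : nat -> R) (t : R) :
  (k < K)%N -> cell K k (t / T) -> sampled T K c t = c k.
Proof.
move=> kK ck; have K0 := leq_ltn_trans (leq0n k) kK.
rewrite /sampled (bigD1 (Ordinal kK))//= indicE mem_set// mul1r big1 ?addr0// => l lk.
rewrite indicE memNset ?mul0r// => cl; move/eqP: lk; apply; apply: val_inj => /=.
exact: (cell_inj K0 cl ck).
Qed.

Lemma sampled_cell (R : realType) (T : R) (K : nat) (t : R) : 0 < T -> (0 < K)%N ->
  t \in `[0, T] -> exists2 k, (k < K)%N & cell K k (t / T).
Proof.
move=> T0 K0; rewrite in_itv /= => /andP[t0 tT].
have h : 0 <= t / T <= 1 by rewrite divr_ge0 ?(ltW T0)//= ler_pdivrMr// mul1r.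
by have [k ck] := cell_exists K0 h; exists k.
Qed.

Lemma measurable_sampled_weight (R : realType) (T : R) (K k : nat) (D : set R) :
  measurable_fun D (fun t => \1_(@cell R K k) (t / T) : R).
Proof.
apply: measurable_funTS; apply: (measurableT_comp (f := \1_(@cell R K k) : R -> R)).
  by apply: measurable_indic; exact: measurable_cell.
exact: mulrr_measurable.
Qed.

Lemma measurable_sampled (R : realType) (T : R) (K : nat) (c : nat -> R) (D : set R) :
  measurable_fun D (sampled T K c).
Proof.
apply: measurable_sum => k; apply: measurable_funM; first exact: measurable_sampled_weight.
exact: measurable_cst.
Qed.

(** * The energy estimate against a sampled reference *)

(** The drift pulls [x] towards [bp / (bp + bm)] at speed [a * (bp + bm)]; the residual of the
    reference is the only forcing. The bound [M] provides integrability and does not enter the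
    estimate, so it may vary with the size of the graph. *)
Lemma forward_equation_energy (R : realType) (T a M x0 : R) (x bp bm : R -> R)
    (K : nat) (c : nat -> R) :
  0 < T -> 0 < a -> (0 < K)%N -> (forall k, 0 <= c k <= 1) ->
  measurable_fun (`[0, T]%classic : set R) bp -> measurable_fun (`[0, T]%classic : set R) bm ->
  (forall t, t \in `[0, T] -> 0 <= bp t <= M) -> (forall t, t \in `[0, T] -> 0 <= bm t <= M) ->
  measurable_fun (`[0, T]%classic : set R) x -> (forall t, t \in `[0, T] -> 0 <= x t <= 1) ->
  (forall t, t \in `[0, T] -> x t = x0 +
     \int[@lebesgue_measure R]_(u in `[0, t]) ((1 - x u) * (a * bp u) - x u * (a * bm u))) ->
  (\int[@lebesgue_measure R]_(t in `[0%R, T])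
      ((bp t + bm t) * (x t - sampled T K c t) ^+ 2)%:E <=
   (K%:R / (2 * a))%:E + \int[@lebesgue_measure R]_(t in `[0%R, T])
      (`|bp t - (bp t + bm t) * sampled T K c t|%R)%:E)%E.
Proof.
move=> T0 a0 K0 c01 mbp mbm bpM bmM mx x01 xE.
set phi := sampled T K c.
have mphi : measurable_fun (`[0, T]%classic : set R) phi by exact: measurable_sampled.
have phi01 t : t \in `[0, T] -> 0 <= phi t <= 1.
  by move=> tT; have [k kK ck] := sampled_cell T0 K0 tT; rewrite /phi (sampledE c kK ck).
pose g u := (1 - x u) * (a * bp u) - x u * (a * bm u).
have mg : measurable_fun (`[0, T]%classic : set R) g.
  apply: measurable_funB; apply: measurable_funM => //.
  - by apply: measurable_funB => //; exact: measurable_cst.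
  - by apply: measurable_funM => //; exact: measurable_cst.
  - by apply: measurable_funM => //; exact: measurable_cst.
have gM t : t \in `[0, T] -> `|g t| <= 2 * (a * M).
  move=> tT; have /andP[? ?] := bpM t tT; have /andP[? ?] := bmM t tT.
  have /andP[? ?] := x01 t tT.
  have h (u b : R) : 0 <= u -> u <= 1 -> 0 <= b -> b <= M -> `|u * (a * b)| <= a * M.
    move=> u0 u1 b0 bM; rewrite ger0_norm ?mulr_ge0// ?(ltW a0)//.
    rewrite -[leRHS]mul1r ler_pM ?mulr_ge0 ?(ltW a0)// ler_wpM2l// ltW//.
  rewrite mulr_natl mulr2n; apply: (le_trans (ler_normB _ _)); apply: lerD; apply: h => //; lra.
pose u t := (bp t + bm t) * (x t - phi t) ^+ 2.
pose v t := `|bp t - (bp t + bm t) * phi t|.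
have mb : measurable_fun (`[0, T]%classic : set R) (fun t => bp t + bm t) by exact: measurable_funD.
have mu : measurable_fun (`[0, T]%classic : set R) u.
  by apply: measurable_funM => //; apply: measurable_funX; exact: measurable_funB.
have mv : measurable_fun (`[0, T]%classic : set R) v.
  apply: measurableT_comp => //; apply: measurable_funB => //; exact: measurable_funM.
have fT : (lebesgue_measure (`[0%R, T]%classic : set R) < +oo)%E.
  by rewrite lebesgue_measure_itv /=; case: ifP; rewrite ltry.
have iu : (@lebesgue_measure R).-integrable `[0, T]%classic (EFin \o u).
  apply: (@integrable_of_bound _ _ _ _ _ _ (2 * M)) => // t tT.
  have /andP[? ?] := bpM t tT; have /andP[? ?] := bmM t tT.
  have /andP[? ?] := x01 t tT; have /andP[? ?] := phi01 t tT.
  rewrite ger0_norm; last by rewrite mulr_ge0 ?sqr_ge0// addr_ge0.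
  rewrite -[leRHS]mulr1 ler_pM ?sqr_ge0//; [exact: addr_ge0|lra|].
  rewrite -subr_ge0 (_ : 1 - _ = (1 - (x t - phi t)) * (1 + (x t - phi t))); last by ring.
  by apply: mulr_ge0; lra.
have iv : (@lebesgue_measure R).-integrable `[0, T]%classic (EFin \o v).
  apply: (@integrable_of_bound _ _ _ _ _ _ (3 * M)) => // t tT.
  have /andP[? ?] := bpM t tT; have /andP[? ?] := bmM t tT.
  have /andP[? ?] := phi01 t tT.
  rewrite normr_id; apply: (le_trans (ler_normB _ _)).
  rewrite (_ : 3 * M = M + 2 * M); last by ring.
  apply: lerD; first by rewrite ger0_norm.
  rewrite ger0_norm ?mulr_ge0 ?addr_ge0// -[leRHS]mulr1 ler_pM ?addr_ge0//; lra.
pose h t := a * u t - a * v t.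
have iau := integrableZl (measurable_itvR _) a iu.
have iav := integrableZl (measurable_itvR _) a iv.
have ih : (@lebesgue_measure R).-integrable `[0, T]%classic (EFin \o h).
  exact: (integrableB (measurable_itvR _) iau iav).
have := integrated_rate_energy T0 mg gM mx x01 xE K0 c01 ih.
have hle k t : (k < K)%N -> t \in `[0, T] -> cell K k (t / T) -> h t <= - ((x t - c k) * g t).
  move=> kK tT ck; rewrite /h /u /v /phi (sampledE c kK ck) /g.
  set y := bp t - _; have /andP[? ?] := x01 t tT; have /andP[? ?] := c01 k.
  rewrite -subr_ge0.
  (* With [y] the residual, the drift is [a * (y - (bp + bm) * (x - c k))]. The cross term is
     absorbed since [x - c k] has modulus at most 1. *)
  rewrite (_ : _ - _ = a * (`|y| - (x t - c k) * y)); last by rewrite /y; ring.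
  rewrite mulr_ge0 ?(ltW a0)// subr_ge0 (le_trans (ler_norm _))// normrM.
  by rewrite ler_piMl// ler_norml; lra.
move=> /(_ hle).
rewrite RintegralB// !RintegralZl// -mulrBr mulrC -ler_pdivlMr//.
rewrite lerBlDr => H.
have fu : (\int[@lebesgue_measure R]_(t in `[0%R, T]) (u t)%:E \is a fin_num)%E.
  exact: (integrable_fin_num (measurable_itvR _) iu).
have fv : (\int[@lebesgue_measure R]_(t in `[0%R, T]) (v t)%:E \is a fin_num)%E.
  exact: (integrable_fin_num (measurable_itvR _) iv).
rewrite -(fineK fu) -(fineK fv) -EFinD lee_fin.
by rewrite invfM mulrA.
Qed.

(** * Integration over space and time *)

Lemma measurable_space_time (R : realType) (T : R) : measurable (@space_time R T).
Proof. by apply: measurableX; [exact: measurable_unit_square|exact: measurable_itv]. Qed.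

(** The residual vanishes when the discrete rates are the limiting ones and [phi = w]; expanding
    around that point gives [(1 - phi) * (bp - betap) - phi * (bm - betam) + (betap + betam) * (w -
    phi)]. *)
Lemma rate_difference_le (R : realType) (bp bm betap betam phi w : R) :
  0 <= betap -> 0 <= betam -> 0 <= phi <= 1 -> w = betap / (betap + betam) ->
  `|bp - (bp + bm) * phi| <=
  2 * (`|bp - betap| + `|bm - betam|) + (betap + betam) * `|w - phi|.
Proof.
move=> p0 m0 /andP[phi0 phi1] wdef.
(* If the total rate is zero, both nonnegative rates vanish and the identity still holds. *)
have wE : (betap + betam) * w = betap.
  have [b0|b0] := eqVneq (betap + betam) 0; last by rewrite wdef mulrC divfK.
  by rewrite b0 mul0r; lra.
have -> : bp - (bp + bm) * phi = (1 - phi) * (bp - betap) - phi * (bm - betam) +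
    (betap + betam) * (w - phi) by rewrite [X in _ = _ + X]mulrBr wE; ring.
apply: (le_trans (ler_normD _ _)); apply: lerD; last first.
  by rewrite normrM ger0_norm// addr_ge0.
apply: (le_trans (ler_normB _ _)); rewrite !normrM.
have h (u y : R) : 0 <= u -> u <= 1 -> `|u| * `|y| <= 2 * `|y|.
  move=> u0 u1; rewrite ler_wpM2r// ger0_norm//; lra.
by rewrite mulrDr; apply: lerD; apply: h; lra.
Qed.

(* The weight [bp + bm >= 2 c] turns the energy bound into an L^1 bound, whereas
   [betap + betam] has no lower bound a priori. *)
Lemma mean_difference_le (R : realType) (bp bm betap betam phi m c delta w : R) :
  0 < c -> 0 < delta -> c <= bp -> c <= bm ->
  2 * c * `|m - w| <= 2 * c * delta + delta^-1 * ((bp + bm) * (m - phi) ^+ 2) +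
   ((`|bp - betap| + `|bm - betam|) * `|w - phi| + (betap + betam) * `|w - phi|).
Proof.
move=> c0 d0 cp cm.
have h1 : 2 * c * `|m - phi| <= 2 * c * delta + delta^-1 * ((bp + bm) * (m - phi) ^+ 2).
  (* A Young inequality: the square is traded against a constant that [delta] makes small. *)
  have : `|m - phi| <= delta + delta^-1 * (m - phi) ^+ 2.
    rewrite -real_normK ?num_real//; set y := `|m - phi|.
    rewrite -subr_ge0 (_ : _ - _ = delta^-1 * ((y - delta / 2) ^+ 2 + 3 / 4 * delta ^+ 2)).
      apply: mulr_ge0; first by rewrite invr_ge0 ltW.
      by apply: addr_ge0; [|apply: mulr_ge0; first lra]; exact: sqr_ge0.
    by field; rewrite gt_eqF.
  move=> h; apply: (@le_trans _ _ (2 * c * (delta + delta^-1 * (m - phi) ^+ 2))).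
    by rewrite ler_wpM2l//; lra.
  rewrite mulrDr lerD2l mulrCA ler_wpM2l ?invr_ge0 ?(ltW d0)//.
  by rewrite ler_wpM2r ?sqr_ge0//; lra.
(* Here [2 * c <= bp + bm], which exceeds [betap + betam] by at most the rate errors. *)
have h2 : 2 * c * `|w - phi| <=
   (`|bp - betap| + `|bm - betam|) * `|w - phi| + (betap + betam) * `|w - phi|.
  rewrite -mulrDl ler_wpM2r//.
  have := ler_norm (bp - betap); have := ler_norm (bm - betam); lra.
apply: (@le_trans _ _ (2 * c * `|m - phi| + 2 * c * `|w - phi|)); last exact: lerD.
rewrite -mulrDr; apply: ler_wpM2l; first lra.
by rewrite (distrC w); exact: ler_distD.
Qed.

Section space_time_integral.
Context {R : realType} (T : R).
Hypothesis T0 : 0 < T.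
Implicit Types f g : R * R -> R -> R.

Definition st_integral f : \bar R := (\int[leb3 R]_(z in space_time T) (f z.1 z.2)%:E)%E.

Definition st_measurable f := measurable_fun (space_time T) (fun z => f z.1 z.2).

Definition st_nonneg f := forall z t, unit_square z -> t \in `[0, T] -> 0 <= f z t.

Lemma le_st_integral f g : st_nonneg f ->
  (forall z t, unit_square z -> t \in `[0, T] -> f z t <= g z t) ->
  (st_integral f <= st_integral g)%E.
Proof.
move=> f0 fg; apply: ge0_le_lower_integral => z [Qz tT]; rewrite lee_fin; first exact: f0.
exact: fg.
Qed.

Lemma st_integralD f g : st_measurable f -> st_measurable g -> st_nonneg f -> st_nonneg g ->
  st_integral (fun z t => f z t + g z t) = (st_integral f + st_integral g)%E.
Proof.
move=> mf mg f0 g0; rewrite /st_integral.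
under eq_integral do rewrite EFinD.
rewrite ge0_integralD//.
- exact: measurable_space_time.
- by move=> z [Qz tT]; rewrite lee_fin; exact: f0.
- exact/measurable_EFinP.
- by move=> z [Qz tT]; rewrite lee_fin; exact: g0.
- exact/measurable_EFinP.
Qed.

Lemma st_integralZ (k : R) f : 0 <= k -> st_measurable f -> st_nonneg f ->
  st_integral (fun z t => k * f z t) = (k%:E * st_integral f)%E.
Proof.
move=> k0 mf f0; rewrite /st_integral.
under eq_integral do rewrite EFinM.
rewrite ge0_integralZl_EFin//.
- exact: measurable_space_time.
- by move=> z [Qz tT]; rewrite lee_fin; exact: f0.
- exact/measurable_EFinP.
Qed.

Lemma st_integral_cst (k : R) : st_integral (fun _ _ => k) = (k * T)%:E.
Proof.
rewrite /st_integral integral_cst; last exact: measurable_space_time.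
have hX : leb3 R (space_time T) =
    (leb2 R (@unit_square R) * lebesgue_measure (`[0%R, T]%classic : set R))%E.
  apply: product_measure1E; [exact: measurable_unit_square|exact: measurable_itv].
rewrite [X in (_ * X)%E]hX leb2_unit_square mul1e lebesgue_measure_itv /= lte_fin T0.
by rewrite oppr0 adde0 -EFinM.
Qed.

End space_time_integral.

Lemma st_measurable_step (R : realType) (T : R) (n : nat) (b : 'I_n -> 'I_n -> R -> R) :
  (forall i j, measurable_fun (`[0, T]%classic : set R) (b i j)) ->
  st_measurable T (fun z t => step_kernel (fun i j => b i j t) z).
Proof.
move=> mb; apply: measurable_sum => i; apply: measurable_sum => j.
apply: measurable_funM.
  exact: (measurable_comp_snd (A := @unit_square R) (measurable_itv _) (mb i j)).
have mC : measurable_fun (@unit_square R) (\1_(cell n i `*` cell n j) : R * R -> R).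
  by apply: measurable_indic; apply: measurableX; exact: measurable_cell.
exact: (measurable_comp_fst (@measurable_unit_square R) mC).
Qed.

Lemma st_measurable_slice1 (R : realType) (T : R) (f : R * R -> R -> R) (t : R) :
  st_measurable T f -> t \in `[0, T] -> measurable_fun (@unit_square R) (f ^~ t).
Proof.
move=> mf tT; exact: (measurable_slice1 (@measurable_unit_square R) (measurable_itv _) mf).
Qed.

Lemma grid_point_itv (R : realType) (T : R) (K k : nat) : 0 < T -> (k < K)%N ->
  T * k%:R / K%:R \in `[0, T].
Proof.
move=> T0 kK; have K0 : (0 < K)%N := leq_ltn_trans (leq0n _) kK.
rewrite in_itv /= -mulrA.
rewrite mulr_ge0 ?(ltW T0) ?divr_ge0//= ger_pMr// ler_pdivrMr ?ltr0n// mul1r ler_nat.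
exact: ltnW.
Qed.

Lemma st_measurable_sampled (R : realType) (T : R) (K : nat) (f : R * R -> R -> R) :
  0 < T -> st_measurable T f ->
  st_measurable T (fun z t => sampled T K (fun k => f z (T * k%:R / K%:R)) t).
Proof.
move=> T0 mf; apply: measurable_sum => k.
have K0 : (0 < K)%N := leq_ltn_trans (leq0n _) (ltn_ord k).
apply: measurable_funM.
  have mk := @measurable_sampled_weight R T K k `[0, T]%classic.
  exact: (measurable_comp_snd (A := @unit_square R) (measurable_itv _) mk).
have mfk := st_measurable_slice1 mf (grid_point_itv T0 (ltn_ord k)).
exact: (measurable_comp_fst (@measurable_unit_square R) mfk).
Qed.

Lemma ratio_bounds (R : realType) (p m : R) : 0 <= p -> 0 <= m -> 0 <= p / (p + m) <= 1.
Proof.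
move=> p0 m0; rewrite divr_ge0 ?addr_ge0//=.
have [->|b0] := eqVneq (p + m) 0; first by rewrite invr0 mulr0 ler01.
by rewrite ler_pdivrMr ?mul1r ?lerDl// lt_neqAle eq_sym b0 addr_ge0.
Qed.

Definition ratio (R : realType) (betap betam : R * R -> R -> R) (z : R * R) (t : R) : R :=
  betap z t / (betap z t + betam z t).

Definition grid_ratio (R : realType) (T : R) (K : nat) (betap betam : R * R -> R -> R)
    (z : R * R) (t : R) : R :=
  sampled T K (fun k => ratio betap betam z (T * k%:R / K%:R)) t.

Definition rate_error (R : realType) (T : R) (n : nat) (bp bm : 'I_n -> 'I_n -> R -> R)
    (betap betam : R * R -> R -> R) : \bar R :=
  (L1_dist T (fun z t => step_kernel (fun i j => bp i j t) z) betap +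
   L1_dist T (fun z t => step_kernel (fun i j => bm i j t) z) betam)%E.

(** The weight removes the points of zero total rate, where the quotient need not be
    left-continuous. *)
Definition grid_error (R : realType) (T : R) (K : nat) (betap betam : R * R -> R -> R) : \bar R :=
  st_integral T (fun z t => (betap z t + betam z t) *
    `|ratio betap betam z t - grid_ratio T K betap betam z t|).

(** Integrates [mean_difference_le] over space and time: the energy estimate controls the square,
    and [rate_difference_le] controls the residual it leaves. [delta] stays free for the final
    optimization. *)
Lemma mean_L1_bound (R : realType) (T a c delta M : R) (n K : nat)
    (bp bm m : 'I_n -> 'I_n -> R -> R) (x0 : 'I_n -> 'I_n -> R)
    (betap betam : R * R -> R -> R) :
  0 < T -> 0 < a -> 0 < c -> 0 < delta -> (0 < n)%N -> (0 < K)%N ->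
  (forall i j, measurable_fun (`[0, T]%classic : set R) (bp i j)) ->
  (forall i j, measurable_fun (`[0, T]%classic : set R) (bm i j)) ->
  (forall i j t, t \in `[0, T] -> c <= bp i j t <= M) ->
  (forall i j t, t \in `[0, T] -> c <= bm i j t <= M) ->
  (forall i j, measurable_fun (`[0, T]%classic : set R) (m i j)) ->
  (forall i j t, t \in `[0, T] -> 0 <= m i j t <= 1) ->
  (forall i j t, t \in `[0, T] -> m i j t = x0 i j + \int[@lebesgue_measure R]_(u in `[0, t])
     ((1 - m i j u) * (a * bp i j u) - m i j u * (a * bm i j u))) ->
  st_measurable T betap -> st_measurable T betam ->
  st_nonneg T betap -> st_nonneg T betam ->
  ((2 * c)%:E * st_integral T
     (fun z t => `|step_kernel (fun i j => m i j t) z - ratio betap betam z t|)%R <=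
   (2 * c * delta * T)%:E + (delta^-1)%:E * ((K%:R / (2 * a))%:E +
     (2%:E * rate_error T bp bm betap betam + grid_error T K betap betam)) +
   (rate_error T bp bm betap betam + grid_error T K betap betam))%E.
Proof.
move=> T0 a0 c0 d0 n0 K0 mbp mbm bpM bmM mm m01 mE mp mn p0 q0.
set E := rate_error _ _ _ _ _; set rho := grid_error _ _ _ _.
pose w := ratio betap betam; pose phi := grid_ratio T K betap betam.
pose Bp z t := step_kernel (fun i j => bp i j t) z.
pose Bm z t := step_kernel (fun i j => bm i j t) z.
pose Mk z t := step_kernel (fun i j => m i j t) z.
have mBp : st_measurable T Bp by exact: st_measurable_step.
have mBm : st_measurable T Bm by exact: st_measurable_step.
have mMk : st_measurable T Mk by exact: st_measurable_step.
have mpn : st_measurable T (fun z t => betap z t + betam z t) by exact: measurable_funD.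
have mw : st_measurable T w.
  apply: measurable_fun_div => //; first exact: measurable_space_time.
  by move=> z [Qz tT]; rewrite addr_ge0 ?p0 ?q0.
have mphi : st_measurable T phi by exact: st_measurable_sampled.
have w01 z t : unit_square z -> t \in `[0, T] -> 0 <= w z t <= 1.
  by move=> Qz tT; apply: ratio_bounds; [exact: p0|exact: q0].
have phiE z k t : (k < K)%N -> cell K k (t / T) -> phi z t = w z (T * k%:R / K%:R).
  by move=> kK ck; rewrite /phi /grid_ratio (sampledE _ kK ck).
have phi01 z t : unit_square z -> t \in `[0, T] -> 0 <= phi z t <= 1.
  move=> Qz tT; have [k kK ck] := sampled_cell T0 K0 tT.
  by rewrite (phiE _ _ _ kK ck); apply: w01 => //; exact: grid_point_itv.
pose D z t := `|Bp z t - betap z t| + `|Bm z t - betam z t|.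
pose r z t := (betap z t + betam z t) * `|w z t - phi z t|.
pose U z t := (Bp z t + Bm z t) * (Mk z t - phi z t) ^+ 2.
pose V z t := `|Bp z t - (Bp z t + Bm z t) * phi z t|.
have Bcp z t : unit_square z -> t \in `[0, T] -> [/\ c <= Bp z t, c <= Bm z t & 0 <= U z t].
  move=> Qz tT; have [i [j [ci cj]]] := unit_square_cells n0 Qz.
  rewrite /U /Bp /Bm !(step_kernelE _ n0 ci cj).
  have /andP[h1 _] := bpM i j t tT; have /andP[h2 _] := bmM i j t tT; split => //.
  by rewrite mulr_ge0 ?sqr_ge0//; lra.
have mDp : st_measurable T (fun z t => `|Bp z t - betap z t|).
  by apply: measurableT_comp => //; exact: measurable_funB.
have mDm : st_measurable T (fun z t => `|Bm z t - betam z t|).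
  by apply: measurableT_comp => //; exact: measurable_funB.
have mD : st_measurable T D by exact: measurable_funD.
have mr : st_measurable T r.
  by apply: measurable_funM => //; apply: measurableT_comp => //; exact: measurable_funB.
have mU : st_measurable T U.
  apply: measurable_funM; first exact: measurable_funD.
  by apply: measurable_funX; exact: measurable_funB.
have mV : st_measurable T V.
  apply: measurableT_comp => //; apply: measurable_funB => //.
  by apply: measurable_funM => //; exact: measurable_funD.
have D0 : st_nonneg T D by move=> z t _ _; exact: addr_ge0.
have r0 : st_nonneg T r by move=> z t Qz tT; rewrite mulr_ge0 ?addr_ge0 ?p0 ?q0.
have U0 : st_nonneg T U by move=> z t Qz tT; have [] := Bcp z t Qz tT.
have V0 : st_nonneg T V by move=> z t _ _; exact: normr_ge0.
have DE : st_integral T D = E by rewrite st_integralD// => z t _ _; exact: normr_ge0.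
have VE : (st_integral T V <= 2%:E * E + rho)%E.
  rewrite -DE -st_integralZ// -[rho]/(st_integral T r) -st_integralD//; last 2 first.
  - by apply: measurable_funM => //; exact: measurable_cst.
  - by move=> z t Qz tT; rewrite mulr_ge0// D0.
  apply: le_st_integral => // z t Qz tT; apply: rate_difference_le => //.
  - exact: p0.
  - exact: q0.
  - exact: phi01.
(* By Tonelli this is the scalar energy estimate at each point of the square, whose unit area leaves
   the constant unchanged. Only [phi] varies within a cell. *)
have UE : (st_integral T U <= (K%:R / (2 * a))%:E + st_integral T V)%E.
  have [_ _ U1 _] := tonelli_space_time mU U0; have [mV1 _ V1 _] := tonelli_space_time mV V0.
  rewrite /st_integral U1 V1.
  have cst0 : 0 <= K%:R / (2 * a) by rewrite divr_ge0// mulr_ge0// ltW.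
  have mQ : measurable (@unit_square R : set (measurableTypeR R * measurableTypeR R)).
    exact: measurable_unit_square.
  have -> : (K%:R / (2 * a))%:E = (\int[leb2 R]_(z in @unit_square R) (K%:R / (2 * a))%:E)%E.
    by rewrite integral_cst// [X in (_ * X)%E]leb2_unit_square mule1.
  rewrite -ge0_integralD//; last first.
  - by move=> z Qz; apply: integral_ge0 => t tT; rewrite lee_fin V0.
  apply: ge0_le_lower_integral => z Qz.
    by apply: integral_ge0 => t tT; rewrite lee_fin U0.
  have [i [j [ci cj]]] := unit_square_cells n0 Qz.
  have Hij b : step_kernel b z = b i j := step_kernelE b n0 ci cj.
  (* The default 0 keeps all values in [[0, 1]], also past the end of the grid, where [w] is not
     controlled. *)
  pose ck k := if (k < K)%N then w z (T * k%:R / K%:R) else 0.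
  have phick t : phi z t = sampled T K ck t.
    by rewrite /phi /grid_ratio /sampled; apply: eq_bigr => k _; rewrite /ck ltn_ord.
  have ck01 k : 0 <= ck k <= 1.
    by rewrite /ck; case: ifP => kK; [apply: w01 => //; exact: grid_point_itv|rewrite lexx ler01].
  have b1 t : t \in `[0, T] -> 0 <= bp i j t <= M.
    by move=> tT; have /andP[? ?] := bpM i j t tT; apply/andP; split => //; lra.
  have b2 t : t \in `[0, T] -> 0 <= bm i j t <= M.
    by move=> tT; have /andP[? ?] := bmM i j t tT; apply/andP; split => //; lra.
  have UE1 t : U z t = (bp i j t + bm i j t) * (m i j t - sampled T K ck t) ^+ 2.
    by rewrite /U /Bp /Bm /Mk !Hij phick.
  have VE1 t : V z t = `|bp i j t - (bp i j t + bm i j t) * sampled T K ck t|.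
    by rewrite /V /Bp /Bm !Hij phick.
  under eq_integral do rewrite UE1.
  under [X in (_ <= _ + X)%E]eq_integral do rewrite VE1.
  exact: (forward_equation_energy T0 a0 K0 ck01 (mbp i j) (mbm i j) b1 b2 (mm i j) (m01 i j)
    (mE i j)).
have dU0 : st_nonneg T (fun z t => delta^-1 * U z t).
  by move=> z t Qz tT; rewrite mulr_ge0 ?invr_ge0 ?(ltW d0)// U0.
have mdU : st_measurable T (fun z t => delta^-1 * U z t).
  by apply: measurable_funM => //; exact: measurable_cst.
have mMw : st_measurable T (fun z t => `|Mk z t - w z t|).
  by apply: measurableT_comp => //; exact: measurable_funB.
have c2 : 0 <= 2 * c by rewrite mulr_ge0// ltW.
have Mw0 : st_nonneg T (fun z t => `|Mk z t - w z t|) by move=> z t _ _; exact: normr_ge0.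
rewrite -(st_integralZ c2 mMw Mw0).
apply: (@le_trans _ _ (st_integral T (fun z t => (2 * c * delta + delta^-1 * U z t) +
    (D z t + r z t)))).
  apply: le_st_integral => [z t _ _|z t Qz tT].
    by rewrite mulr_ge0// mulr_ge0// ltW.
  have [h1 h2 _] := Bcp z t Qz tT.
  apply: (le_trans (mean_difference_le (betap z t) (betam z t) (phi z t) (Mk z t) (w z t)
    c0 d0 h1 h2)).
  rewrite lerD2l lerD2r ler_piMr ?D0// ler_norml.
  by have /andP[? ?] := w01 z t Qz tT; have /andP[? ?] := phi01 z t Qz tT; lra.
have cd0 : 0 <= 2 * c * delta by rewrite !mulr_ge0// ltW.
have mcst (k : R) : st_measurable T (fun _ _ => k) by exact: measurable_cst.
have mcdU : st_measurable T (fun z t => 2 * c * delta + delta^-1 * U z t) by exact: measurable_funD.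
have mDr : st_measurable T (fun z t => D z t + r z t) by exact: measurable_funD.
have cdU0 : st_nonneg T (fun z t => 2 * c * delta + delta^-1 * U z t).
  by move=> z t Qz tT; rewrite addr_ge0// dU0.
have Dr0 : st_nonneg T (fun z t => D z t + r z t).
  by move=> z t Qz tT; rewrite addr_ge0// ?D0 ?r0.
have cd0' : st_nonneg T (fun _ _ => 2 * c * delta) by [].
have id0 : 0 <= delta^-1 by rewrite invr_ge0 ltW.
rewrite (st_integralD mcdU mDr cdU0 Dr0) (st_integralD (mcst _) mdU cd0' dU0).
rewrite (st_integralD mD mr D0 r0) (st_integral_cst T0) (st_integralZ id0 mU U0) DE.
rewrite leeD2r// leeD2l// lee_wpmul2l ?lee_fin//.
exact: (le_trans UE (leeD2l _ VE)).
Qed.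

(** * Sampling in time *)

(** Sampling the identity yields grid points adjacent to [t]. Left ones serve the left-continuous
    rates, right ones the right-continuous paths. *)
Definition left_grid (R : realType) (T : R) (K : nat) : R -> R :=
  sampled T K (fun k => T * k%:R / K%:R).

Definition right_grid (R : realType) (T : R) (K : nat) : R -> R :=
  sampled T K (fun k => T * k.+1%:R / K%:R).

Lemma sampled_left_grid (R : realType) (T : R) (K : nat) (f : R -> R) (t : R) :
  0 < T -> (0 < K)%N -> t \in `[0, T] ->
  sampled T K (fun k => f (T * k%:R / K%:R)) t = f (left_grid T K t).
Proof.
move=> T0 K0 tT; have [k kK ck] := sampled_cell T0 K0 tT.
by rewrite /left_grid !(sampledE _ kK ck).
Qed.

Lemma sampled_right_grid (R : realType) (T : R) (K : nat) (f : R -> R) (t : R) :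
  0 < T -> (0 < K)%N -> t \in `[0, T] ->
  sampled T K (fun k => f (T * k.+1%:R / K%:R)) t = f (right_grid T K t).
Proof.
move=> T0 K0 tT; have [k kK ck] := sampled_cell T0 K0 tT.
by rewrite /right_grid !(sampledE _ kK ck).
Qed.

Lemma cell_scaled_bounds (R : realType) (T : R) (K k : nat) (t : R) : 0 < T -> (0 < K)%N ->
  cell K k (t / T) ->
  [/\ T * k%:R / K%:R <= t, t <= T * k.+1%:R / K%:R & (0 < k)%N -> T * k%:R / K%:R < t].
Proof.
move=> T0 K0 ck; have K0' : 0 < K%:R :> R by rewrite ltr0n.
have tE : t = T * (t / T * K%:R) / K%:R by field; rewrite !gt_eqF.
have [_ h1 h2 h3] := cell_bounds K0 ck; split=> [||k0].
- by rewrite [leRHS]tE ler_pM2r ?invr_gt0// ler_pM2l.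
- by rewrite [leLHS]tE ler_pM2r ?invr_gt0// ler_pM2l.
- by rewrite [ltRHS]tE ltr_pM2r ?invr_gt0// ltr_pM2l// h3.
Qed.

(** Strictness for [0 < t] matters because a left limit ignores the point itself; cells are open on
    the left, except the first, whose grid point is 0. *)
Lemma left_grid_bounds (R : realType) (T : R) (K : nat) (t : R) :
  0 < T -> (0 < K)%N -> t \in `[0, T] ->
  [/\ 0 <= left_grid T K t, left_grid T K t <= t, 0 < t -> left_grid T K t < t
    & t - left_grid T K t <= T / K%:R].
Proof.
move=> T0 K0 tT; have [k kK ck] := sampled_cell T0 K0 tT.
rewrite /left_grid (sampledE _ kK ck); have [h1 h2 h3] := cell_scaled_bounds T0 K0 ck.
split => //; first by rewrite !mulr_ge0// ?invr_ge0// ltW.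
  by move=> t0; case: (posnP k) => [->|/h3//]; rewrite mulr0 mul0r.
by rewrite lerBlDl -mulrDl -[X in _ + X](mulr1 T) -mulrDr natr1.
Qed.

Lemma right_grid_bounds (R : realType) (T : R) (K : nat) (t : R) :
  0 < T -> (0 < K)%N -> t \in `[0, T] ->
  [/\ t <= right_grid T K t, right_grid T K t <= T & right_grid T K t - t <= T / K%:R].
Proof.
move=> T0 K0 tT; have [k kK ck] := sampled_cell T0 K0 tT.
have K0' : 0 < K%:R :> R by rewrite ltr0n.
rewrite /right_grid (sampledE _ kK ck); have [h1 h2 h3] := cell_scaled_bounds T0 K0 ck.
split => //.
  by rewrite ler_pdivrMr// ler_wpM2l ?(ltW T0)// ler_nat.
by rewrite lerBlDl -lerBlDr -mulrBl -[X in _ - X](mulr1 T) -mulrBr -natr1 addrK.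
Qed.

Lemma step_size_cvg (R : realType) (T : R) : T / N.+1%:R @[N --> \oo] --> 0.
Proof.
rewrite -(mulr0 T); apply: cvgMr; exact: cvg_harmonic.
Qed.

Lemma left_grid_cvg (R : realType) (T t : R) : 0 < T -> t \in `[0, T] ->
  left_grid T N.+1 t @[N --> \oo] --> t.
Proof.
move=> T0 tT; apply/cvgrPdist_le => e e0.
have := step_size_cvg T; move=> /cvgrPdist_le /(_ e e0); apply: filterS => N.
have [_ h1 _ h2] := left_grid_bounds T0 (ltn0Sn N) tT.
rewrite sub0r normrN ger0_norm ?divr_ge0 ?(ltW T0)// => h.
by rewrite ger0_norm ?subr_ge0// (le_trans h2).
Qed.

Lemma right_grid_cvg (R : realType) (T t : R) : 0 < T -> t \in `[0, T] ->
  right_grid T N.+1 t @[N --> \oo] --> t.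
Proof.
move=> T0 tT; apply/cvgrPdist_le => e e0.
have := step_size_cvg T; move=> /cvgrPdist_le /(_ e e0); apply: filterS => N.
have [h1 _ h2] := right_grid_bounds T0 (ltn0Sn N) tT.
rewrite sub0r normrN ger0_norm ?divr_ge0 ?(ltW T0)// => h.
by rewrite distrC ger0_norm ?subr_ge0// (le_trans h2).
Qed.

(** Dominated convergence with majorant [betap + betam], both ratios lying in [[0, 1]]. *)
Lemma grid_error_cvg (R : realType) (T : R) (betap betam : R * R -> R -> R) : 0 < T ->
  st_measurable T betap -> st_measurable T betam ->
  st_nonneg T betap -> st_nonneg T betam ->
  L1_space_time T betap -> L1_space_time T betam ->
  {ae leb2 R, forall z, unit_square z ->
     bounded_left_continuous T (betap z) /\ bounded_left_continuous T (betam z)} ->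
  grid_error T N.+1 betap betam @[N --> \oo] --> 0%E.
Proof.
move=> T0 mp mq p0 q0 ip iq lc.
pose b z t := betap z t + betam z t.
pose f_ N (z : R * R * R) :=
  (b z.1 z.2 * `|ratio betap betam z.1 z.2 - grid_ratio T N.+1 betap betam z.1 z.2|)%:E.
have mb : st_measurable T b by exact: measurable_funD.
have mw : st_measurable T (ratio betap betam).
  apply: measurable_fun_div => //; first exact: measurable_space_time.
  by move=> z [Qz tT]; rewrite addr_ge0 ?p0 ?q0.
have mf N : measurable_fun (space_time T) (f_ N).
  apply/measurable_EFinP; apply: measurable_funM => //; apply: measurableT_comp => //.
  by apply: measurable_funB => //; exact: st_measurable_sampled.
have w01 z t : unit_square z -> t \in `[0, T] -> 0 <= ratio betap betam z t <= 1.
  by move=> Qz tT; apply: ratio_bounds; [exact: p0|exact: q0].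
have gridE N z t : t \in `[0, T] ->
    grid_ratio T N.+1 betap betam z t = ratio betap betam z (left_grid T N.+1 t).
  by move=> tT; rewrite /grid_ratio sampled_left_grid.
have gT N t : t \in `[0, T] -> left_grid T N.+1 t \in `[0, T].
  move=> tT; have [h0 h1 _ _] := left_grid_bounds T0 (ltn0Sn N) tT.
  by move: tT; rewrite !in_itv /= h0 => /andP[_]; exact: le_trans.
have pointwise z t : unit_square z -> t \in `[0, T] ->
    bounded_left_continuous T (betap z) -> bounded_left_continuous T (betam z) ->
    f_ N (z, t) @[N --> \oo] --> 0%E.
  move=> Qz tT [_ lp] [_ lm]; apply: cvg_EFin; first exact: nearW.
  rewrite /f_ /=; have [b0|b0] := eqVneq (b z t) 0.
    by rewrite b0; under eq_fun do rewrite mul0r; exact: cvg_cst.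
  rewrite -(mulr0 (b z t)); apply: cvgMr; rewrite -(normr0 R); apply: cvg_norm.
  rewrite -(subrr (ratio betap betam z t)); apply: cvgB; first exact: cvg_cst.
  under eq_fun do rewrite gridE//.
  have [t0|t0] := ltP 0 t.
    have tT' : t \in `]0, T] by move: tT; rewrite !in_itv /= t0 => /andP[_ ->].
    have cw : ratio betap betam z s @[s --> t^'-] --> ratio betap betam z t.
      apply: cvgM; first exact: lp.
      by apply: cvgV => //; apply: cvgD; [exact: lp|exact: lm].
    apply: (cvg_at_leftP _ _ _).1 cw _ _; split; last exact: left_grid_cvg.
    by move=> N; have [_ _ + _] := left_grid_bounds T0 (ltn0Sn N) tT; apply.
  (* Left continuity says nothing at time 0, but there the grid point is 0 itself. *)
  have {t0}te : t = 0 by move: tT; rewrite in_itv /= => /andP[h _]; apply/eqP; rewrite eq_le t0 h.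
  have -> : (fun N => ratio betap betam z (left_grid T N.+1 t)) = cst (ratio betap betam z t).
    apply/funext => N; congr (ratio _ _ _ _).
    have [h0 h1 _ _] := left_grid_bounds T0 (ltn0Sn N) tT.
    by apply/eqP; rewrite eq_le h1 /= [X in X <= _]te h0.
  exact: cvg_cst.
have ae3 : {ae leb3 R, forall z, space_time T z -> f_ N z @[N --> \oo] --> 0%E}.
  have [S [mS S0 hS]] := lc.
  exists (S `*` setT); split.
  - exact: measurableX.
  - have hX : leb3 R (S `*` setT) = (leb2 R S * lebesgue_measure (setT : set R))%E.
      exact: product_measure1E.
    by rewrite [LHS]hX [X in (X * _)%E]S0 mul0e.
  - move=> [z t] /= /not_implyP[[/= Qz tT] nf]; split => //=.
    apply: hS => /= h; apply: nf; have [h1 h2] := h Qz.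
    exact: pointwise.
have mST : measurable
    (space_time T : set (measurableTypeR R * measurableTypeR R * measurableTypeR R)).
  exact: measurable_space_time.
have ib : (leb3 R).-integrable (space_time T) (fun z => (b z.1 z.2)%:E).
  have := integrableD mST ip iq.
  by apply: eq_integrable.
have dom : {ae leb3 R, forall z, forall N, space_time T z -> (`|f_ N z| <= (b z.1 z.2)%:E)%E}.
  apply: aeW => z N [Qz tT]; rewrite /f_ abse_EFin lee_fin.
  have b0 : 0 <= b z.1 z.2 by rewrite addr_ge0 ?p0 ?q0.
  rewrite ger0_norm ?mulr_ge0// ler_piMr// gridE// ler_norml.
  have /andP[? ?] := w01 z.1 z.2 Qz tT.
  have /andP[? ?] := w01 z.1 _ Qz (gT N _ tT); lra.
have [_ _] := dominated_convergence mST mf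
  (measurable_cst (0%E : \bar R)) ae3 ib dom.
by rewrite integral0.
Qed.

(** * Almost sure convergence *)

Lemma cvg0_ereal (R : realType) (u : nat -> \bar R) : (forall n, 0 <= u n)%E ->
  (forall e : R, 0 < e -> \forall n \near \oo, (u n <= e%:E)%E) -> u n @[n --> \oo] --> 0%E.
Proof.
move=> u0 ue; apply/fine_cvgP; split.
  have := ue 1 ltr01; apply: filterS => n h; rewrite ge0_fin_numE//.
  by rewrite (le_lt_trans h)// ltry.
apply/cvgrPdist_le => e e0; have := ue e e0; apply: filterS => n h.
rewrite sub0r normrN ger0_norm; last exact: fine_ge0.
by rewrite -lee_fin fineK// ge0_fin_numE// (le_lt_trans h)// ltry.
Qed.

Lemma ereal_cvg0_le (R : realType) (u : nat -> \bar R) (e : R) : 0 < e ->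
  u n @[n --> \oo] --> 0%E -> \forall n \near \oo, (u n <= e%:E)%E.
Proof.
move=> e0 /fine_cvgP[uf /cvgrPdist_le /(_ e e0) h].
near=> n; have nf : u n \is a fin_num by near: n.
rewrite -(fineK nf) lee_fin; apply: (le_trans (ler_norm _)).
rewrite -normrN -sub0r; near: n; exact: h.
Unshelve. all: by end_near. Qed.

(** The series of the [Z n] from rank [N] on has a finite integral, so it converges almost
    everywhere and its terms tend to 0. *)
Lemma ae_cvg0_of_geometric_integrals d (T : measurableType d) (R : realType)
    (mu : {measure set T -> \bar R}) (Z : nat -> T -> \bar R) (C : R) (N : nat) : 0 <= C ->
  (forall n, measurable_fun setT (Z n)) -> (forall n x, 0 <= Z n x)%E ->
  (forall n, (N <= n)%N -> (\int[mu]_x Z n x <= (C / (2 ^ n.+1)%:R)%:E)%E) ->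
  {ae mu, forall x, Z n x @[n --> \oo] --> 0%E}.
Proof.
move=> C0 mZ Z0 ZC; pose W n x := Z (n + N)%N x.
pose S x := (\sum_(0 <= n <oo) W n x)%E.
have S0 x : (0 <= S x)%E by apply: nneseries_ge0 => n _ _; exact: Z0.
have mS : measurable_fun setT S.
  by apply: (ge0_emeasurable_sum (P := xpredT)) => [n x _ _|n _]; [exact: Z0|exact: mZ].
have intS : (\int[mu]_x S x <= C%:E)%E.
  rewrite (integral_nneseries mu measurableT (fun n => mZ (n + N)%N) (fun n x _ => Z0 _ x)).
  apply: le_trans (epsilon_trick0 xpredT C0); apply: lee_nneseries => [n _ _|n _].
    by apply: integral_ge0 => x _; exact: Z0.
  apply: (le_trans (ZC _ (leq_addl _ _))); rewrite lee_fin ler_wpM2l//.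
  rewrite lef_pV2 ?posrE ?ltr0n ?expn_gt0// ler_nat leq_exp2l//.
  by rewrite ltnS leq_addr.
have iS : mu.-integrable setT S.
  apply/integrableP; split => //; apply: le_lt_trans (ltry C).
  by under eq_integral do rewrite gee0_abs//.
have := integrable_ae measurableT iS; apply: filterS => x /(_ I) Sfin.
rewrite -(cvg_shiftn N) -/(W ^~ x).
have Soo : (\sum_(0 <= n <oo) W n x < +oo)%E by rewrite -ge0_fin_numE//; exact: S0.
have W0 n : (0 <= W n x)%E by exact: Z0.
apply: squeeze_cvge (cvg_cst 0%E) (nneseries_tail_cvg Soo (fun n _ => W0 n)).
apply: nearW => n; rewrite W0/= (nneseries_split n 1)// addn1 big_nat1 leeDl//.
by apply: nneseries_ge0.
Qed.

(** Joint measurability, as Tonelli requires: evaluating at the next grid point gives measurable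
    approximations, which converge by right continuity. *)
Lemma measurable_right_continuous d (Omega : measurableType d) (R : realType) (T : R)
    (x : R -> Omega -> bool) : 0 < T ->
  (forall t, t \in `[0, T] -> measurable_fun setT (x t)) ->
  (forall omega t, t \in `[0, T[ -> x s omega @[s --> t^'+] --> x t omega) ->
  measurable_fun ([set: Omega] `*` `[0, T]%classic)
    (fun z : Omega * R => (x z.2 z.1)%:R : R).
Proof.
move=> T0 mx rc.
pose h N (z : Omega * R) : R :=
  sampled T N.+1 (fun k => (x (T * k.+1%:R / N.+1%:R) z.1)%:R) z.2.
have mbool : measurable_fun setT (fun b : bool => b%:R : R) by [].
apply: (@measurable_fun_cvg _ _ _ _ h).
  move=> N; apply: measurable_sum => k; apply: measurable_funM.
    have mk := @measurable_sampled_weight R T N.+1 k `[0, T]%classic.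
    exact: (measurable_comp_snd (A := [set: Omega]) (measurable_itv _) mk).
  have mXk : measurable_fun setT (fun w => (x (T * k.+1%:R / N.+1%:R) w)%:R : R).
    apply: (measurableT_comp mbool); apply: mx; rewrite in_itv /=.
    rewrite divr_ge0 ?mulr_ge0 ?(ltW T0)//= ler_pdivrMr ?ltr0n//.
    by rewrite ler_wpM2l ?(ltW T0)// ler_nat.
  exact: (measurable_comp_fst (B := `[0, T]%classic) measurableT mXk).
move=> [w t] [_ /= tT].
have hE N : h N (w, t) = (x (right_grid T N.+1 t) w)%:R.
  by rewrite /h /= (sampled_right_grid (fun s => (x s w)%:R)).
apply: cvg_near_cst; rewrite /=.
(* At the final time the right grid point is [T] itself. *)
have [tT'|tT'] := ltP t T; last first.
  apply: nearW => N; rewrite hE; congr (nat_of_bool _)%:R; congr (x _ w).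
  have [h1 h2 _] := right_grid_bounds T0 (ltn0Sn N) tT.
  apply/eqP; rewrite eq_le h1 andbT; exact: (le_trans h2).
have tc : t \in `[0, T[ by move: tT; rewrite !in_itv /= tT' => /andP[->].
have := rc w t tc => /(_ [set x t w]) /=.
have nb : nbhs (x t w) [set x t w] by exact: discrete_set1.
move=> /(_ nb) near_t.
(* In a discrete space convergence means eventual equality. The implication is there because the
   right neighbourhood excludes [t], which may be a grid point. *)
have : \forall N \near \oo, t < right_grid T N.+1 t -> x (right_grid T N.+1 t) w = x t w.
  exact: (right_grid_cvg T0 tT near_t).
apply: filterS => N hN; rewrite hE.
have [h1 _ _] := right_grid_bounds T0 (ltn0Sn N) tT.
move: h1; rewrite le_eqVlt => /predU1P[<-//|h1].
by rewrite (hN h1).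
Qed.

Definition mean_path d (Omega : measurableType d) (R : realType) (P : probability Omega R)
    (X : R -> Omega -> bool) (t : R) : R := fine (P (X t @^-1` [set true])).

(** Conditioning at time 0 is trivial for a deterministic start, so the mean is [p 0 t x0 true] and
    inherits the forward equation. *)
Lemma markov_chain_mean d (Omega : measurableType d) (R : realType) (P : probability Omega R)
    (T : R) (r : R -> bool -> R) (X : R -> Omega -> bool) (x0 : bool) :
  0 < T -> markov_chain P T r X -> (forall omega, X 0 omega = x0) ->
  [/\ forall t, t \in `[0, T] -> P (X t @^-1` [set true]) = (mean_path P X t)%:E,
      forall t, t \in `[0, T] -> 0 <= mean_path P X t <= 1,
      measurable_fun (`[0, T]%classic : set R) (mean_path P X) &
      forall t, t \in `[0, T] -> mean_path P X t = x0%:R +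
        \int[@lebesgue_measure R]_(u in `[0, t])
          ((1 - mean_path P X u) * r u false - mean_path P X u * r u true)].
Proof.
move=> T0 [mX _ [p ptr pP]] X0.
have zT : (0 : R) \in `[0, T] by rewrite in_itv /= lexx ltW.
have [p0 p1 mp pE] := ptr 0 zT.
have PE t : t \in `[0, T] -> P (X t @^-1` [set true]) = (p 0 t x0 true)%:E.
  move=> tT; have hT : history X 0 [set: Omega] by exact: (@measurableT _ (g_sigma_algebraType _)).
  have X0T : X 0 @^-1` [set x0] = setT by apply/seteqP; split => w //= _.
  have := pP 0 t setT x0 true zT tT hT.
  by rewrite X0T !setTI probability_setT mul1e.
have mE t : t \in `[0, T] -> mean_path P X t = p 0 t x0 true.
  by move=> tT; rewrite /mean_path PE.
have pF t : t \in `[0, T] -> p 0 t x0 false = 1 - mean_path P X t.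
  by move=> tT; have := p1 t x0 tT; rewrite big_bool /= mE// => <-; rewrite addrAC subrr add0r.
split.
- by move=> t tT; rewrite PE// mE.
- move=> t tT; rewrite mE// p0//= -subr_ge0.
  by have := pF t tT; rewrite mE// => <-; exact: p0.
- by apply: (eq_measurable_fun (fun t => p 0 t x0 true)) => // t /set_mem tT; rewrite mE.
- move=> t tT; rewrite mE// (pE t x0 true tT) eqb_id; congr (_ + _).
  apply: eq_Rintegral => u /set_mem /=; rewrite in_itv /= => /andP[u0 ut].
  have uT : u \in `[0, T].
    by move: tT; rewrite !in_itv /= u0 => /andP[_]; exact: le_trans.
  by rewrite pF// mE.
Qed.

Lemma history_joint_law d (Omega : measurableType d) (R : realType) (P : probability Omega R)
    (T t : R) (I : finType) (X : I -> R -> Omega -> bool) (y : I -> bool) :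
  mutually_independent P (fun i => history (X i) T) -> t \in `[0, T] ->
  P (\bigcap_(i in [set: I]) X i t @^-1` [set y i]) =
  (\prod_i P (X i t @^-1` [set y i]))%E.
Proof.
move=> ind tT; have := ind [set: I]%SET (fun i => X i t @^-1` [set y i]) _.
have -> : [set` [set: I]%SET] = [set: I] by apply/seteqP; split => i //= _; rewrite inE.
move=> -> //; first by apply: eq_bigl => i; rewrite inE.
by move=> i _; apply: sub_gen_smallest; exists t => //; exists (y i).
Qed.

(** Once [7 <= n * s], [expR (n * s) >= 1 + 7 = 8], and [2 * 4 ^ n / 8 ^ n = 4 / 2 ^ (n + 1)]. *)
Lemma geometric_tail (R : realType) (s C : R) : 0 < s -> 0 <= C ->
  exists N : nat, forall n, (N <= n)%N ->
    C * (2 * 4 ^+ n * expR (n%:R ^+ 2 * - s)) <= 4 * C / (2 ^ n.+1)%:R.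
Proof.
move=> s0 C0; exists (Num.truncn (7 / s)).+1 => n Nn.
have ns : 7 <= n%:R * s.
  rewrite -ler_pdivrMr// (le_trans (ltW (truncnS_gt _)))// ler_nat//.
have h8 : expR (n%:R * - s) <= 8^-1.
  rewrite mulrN expRN lef_pV2 ?posrE ?expR_gt0//.
  by apply: le_trans (expR_ge1Dx _); lra.
have -> : expR (n%:R ^+ 2 * - s) = expR (n%:R * - s) ^+ n.
  by rewrite -expRM_natl mulrA expr2.
have h8n : expR (n%:R * - s) ^+ n <= 8^-1 ^+ n.
  by rewrite lerXn2r ?nnegrE ?expR_ge0 ?invr_ge0.
have -> : 4 * C / (2 ^ n.+1)%:R = C * (2 * 4 ^+ n * 8^-1 ^+ n).
  have -> : (2 ^ n.+1)%:R = 2 * 2 ^+ n :> R by rewrite natrX exprS.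
  have -> : 8^-1 ^+ n = (4 ^+ n)^-1 * (2 ^+ n)^-1 :> R.
    by rewrite -!exprVn -exprMn; congr (_ ^+ _); lra.
  by field; rewrite !expf_neq0.
by rewrite !ler_wpM2l// mulr_ge0// exprn_ge0.
Qed.

Lemma measurable_cut_partition d (T : measurableType d) (R : realType) (lam eps : R) (n : nat)
    (D : set T) (c : 'I_n -> 'I_n -> T -> R) : (forall i j, measurable_fun D (c i j)) ->
  measurable_fun D (fun x => cut_partition lam eps (fun i j => c i j x)).
Proof.
move=> mc; apply: measurable_sum => k.
apply: (measurableT_comp (@measurable_expR R)).
apply: measurable_funM; first exact: measurable_cst.
apply: measurable_funB; last exact: measurable_cst.
apply: measurable_funM; first exact: measurable_cst.
have -> : (fun x => \sum_(i in k.1.2) \sum_(j in k.2) c i j x) =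
    (fun x => \sum_i \sum_j (if (i \in k.1.2) && (j \in k.2) then c i j x else 0)).
  apply/funext => x; rewrite big_mkcond; apply: eq_bigr => i _.
  by case: ifP => _ /=; [rewrite big_mkcond|rewrite big1].
apply: measurable_sum => i; apply: measurable_sum => j.
by case: ((i \in k.1.2) && (j \in k.2)); [exact: mc|exact: measurable_cst].
Qed.

(** The choice [lam = eps / 4] minimizes [2 * lam ^+ 2 - lam * eps], with value [- eps ^+ 2 / 8];
    [eps <= 1] keeps [lam] below 1/2, as the moment bound demands. *)
Lemma cut_partition_ae_cvg d (Omega : measurableType d) (R : realType) (P : probability Omega R)
    (T eps : R) (X : forall n : nat, 'I_n -> 'I_n -> R -> Omega -> bool)
    (q : forall n : nat, 'I_n -> 'I_n -> R -> R) :
  0 < T -> 0 < eps <= 1 ->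
  (forall n i j t, t \in `[0, T] -> measurable_fun setT (X n i j t)) ->
  (forall n i j omega, cadlag T (X n i j ^~ omega)) ->
  (forall n (i j : 'I_n), measurable_fun (`[0, T]%classic : set R) (q n i j)) ->
  (forall n (i j : 'I_n) t, t \in `[0, T] -> P (X n i j t @^-1` [set true]) = (q n i j t)%:E) ->
  (forall n, mutually_independent P (fun ij : 'I_n * 'I_n => history (X n ij.1 ij.2) T)) ->
  {ae P, forall omega, (\int[@lebesgue_measure R]_(t in `[0%R, T])
     (cut_partition (eps / 4) eps (fun i j => (X n i j t omega)%:R - q n i j t)%R)%:E)%E
     @[n --> \oo] --> 0%E}.
Proof.
move=> T0 /andP[e0 e1] mX cX mq Pq ind.
pose G n (z : Omega * R) := cut_partition (eps / 4) eps
   (fun i j : 'I_n => (X n i j z.2 z.1)%:R - q n i j z.2).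
have mG n : measurable_fun ([set: Omega] `*` `[0, T]%classic) (fun z => (G n z)%:E).
  apply/measurable_EFinP; apply: measurable_cut_partition => i j.
  apply: measurable_funB.
    apply: measurable_right_continuous => // [t|w t]; first exact: mX.
    by have [+ _] := cX n i j w; exact.
  exact: (measurable_comp_snd (A := [set: Omega]) (measurable_itv _) (mq n i j)).
have G0 n z : ([set: Omega] `*` `[0, T]%classic) z -> (0 <= (G n z)%:E)%E.
  by move=> _; rewrite lee_fin; exact: cut_partition_ge0.
pose Z n w := (\int[@lebesgue_measure R]_(t in `[0%R, T]) (G n (w, t))%:E)%E.
pose s := eps ^+ 2 / 8.
have s0 : 0 < s by rewrite divr_gt0// exprn_gt0.
have [N hN] := geometric_tail s0 (ltW T0).
have ton n := tonelli_setX P (@lebesgue_measure R) measurableT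
  (measurable_itv `[0, T]) (mG n) (G0 n).
apply: (@ae_cvg0_of_geometric_integrals _ _ _ P Z (4 * T) N).
- by rewrite mulr_ge0// ltW.
- by move=> n; have [] := ton n.
- by move=> n w; apply: integral_ge0 => t _; rewrite lee_fin; exact: cut_partition_ge0.
move=> n /hN Nn; have [_ _ I1 I2] := ton n.
rewrite /Z -I1 I2.
apply: (@le_trans _ _ (\int[@lebesgue_measure R]_(t in `[0%R, T])
   (2 * 4 ^+ n * expR (n%:R ^+ 2 * - s))%:E)%E).
  apply: ge0_le_lower_integral => t tT.
    by apply: integral_ge0 => w _; rewrite lee_fin; exact: cut_partition_ge0.
  have := @expectation_cut_partition _ _ _ P n (fun i j => X n i j t) (fun i j => q n i j t)
    (eps / 4) eps.
  have -> : 2 * (eps / 4) ^+ 2 - eps / 4 * eps = - s by rewrite /s; field.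
  apply.
  - by move=> i j; exact: mX.
  - by move=> y; exact: (history_joint_law y (ind n)).
  - by move=> i j; exact: Pq.
  - by apply/andP; split; lra.
rewrite integral_cst//= lebesgue_measure_itv /= lte_fin T0 oppr0 adde0 -EFinM lee_fin.
by rewrite mulrC.
Qed.

(** * The theorem *)

Lemma finite_upper_bound (R : realType) (I : finType) (P : I -> R -> Prop) :
  (forall i M N, M <= N -> P i M -> P i N) -> (forall i, exists M, P i M) ->
  exists M, forall i, P i M.
Proof.
move=> Pm /choice[f Pf]; exists (\sum_i `|f i|) => i; apply: Pm (Pf i).
by rewrite (bigD1 i)//= (le_trans (ler_norm _))// lerDl sumr_ge0.
Qed.

Lemma mean_L1_cvg (R : realType) (T c : R) (a : nat -> R)
    (bp bm q : forall n : nat, 'I_n -> 'I_n -> R -> R) (x0 : forall n : nat, 'I_n -> 'I_n -> R)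
    (betap betam : R * R -> R -> R) :
  0 < T -> 0 < c -> (forall n, (0 < n)%N -> 0 < a n) -> a n @[n --> \oo] --> +oo ->
  st_measurable T betap -> st_measurable T betam ->
  st_nonneg T betap -> st_nonneg T betam ->
  L1_space_time T betap -> L1_space_time T betam ->
  {ae leb2 R, forall z, unit_square z ->
     bounded_left_continuous T (betap z) /\ bounded_left_continuous T (betam z)} ->
  (forall n (i j : 'I_n), measurable_fun (`[0, T]%classic : set R) (bp n i j) /\
     measurable_fun (`[0, T]%classic : set R) (bm n i j)) ->
  (forall n (i j : 'I_n) (t : R), t \in `[0, T] -> c <= bp n i j t /\ c <= bm n i j t) ->
  (\forall n \near \oo, forall i j : 'I_n, bounded_left_continuous T (bp n i j) /\
     bounded_left_continuous T (bm n i j)) ->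
  L1_dist T (fun z t => step_kernel (fun i j => bp n i j t) z) betap @[n --> \oo] --> 0%E ->
  L1_dist T (fun z t => step_kernel (fun i j => bm n i j t) z) betam @[n --> \oo] --> 0%E ->
  (forall n (i j : 'I_n), measurable_fun (`[0, T]%classic : set R) (q n i j)) ->
  (forall n (i j : 'I_n) t, t \in `[0, T] -> 0 <= q n i j t <= 1) ->
  (forall n (i j : 'I_n) t, t \in `[0, T] -> q n i j t = x0 n i j +
     \int[@lebesgue_measure R]_(u in `[0, t])
       ((1 - q n i j u) * (a n * bp n i j u) - q n i j u * (a n * bm n i j u))) ->
  st_integral T (fun z t =>
    `|step_kernel (fun i j => q n i j t) z - ratio betap betam z t|) @[n --> \oo] --> 0%E.
Proof.
move=> T0 c0 a0 aoo mp mm p0 m0 ip im lc mb bc blc cp cm mq q01 qE.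
apply: cvg0_ereal => [n|e e0].
  by apply: integral_ge0 => z _; rewrite lee_fin normr_ge0.
(* The target is [2 * c * e]. This [delta] makes the constant term [c * e / 2]; the other terms
   total [4 * eta / delta + 2 * eta], less than [c * e] by the choice of [eta]. *)
pose delta := e / (4 * T); have d0 : 0 < delta by rewrite divr_gt0// mulr_gt0.
pose eta := c * e / (4 * delta^-1 + 3).
have den0 : 0 < 4 * delta^-1 + 3 by rewrite addr_gt0// mulr_gt0// invr_gt0.
have eta0 : 0 < eta by rewrite divr_gt0// mulr_gt0.
(* The grid is fixed before [n], so that the energy cost of its intervals vanishes as [a n]
   grows. *)
have [K _ hK] := ereal_cvg0_le eta0 (grid_error_cvg T0 mp mm p0 m0 ip im lc).
have {}hK := hK K (leqnn K); rewrite /= in hK.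
have eta20 : 0 < eta / 2 by rewrite divr_gt0.
near=> n.
have n0 : (0 < n)%N by near: n; exact: nbhs_infty_gt.
have an0 := a0 n n0.
have hp : (L1_dist T (fun z t => step_kernel (fun i j => bp n i j t) z) betap <= (eta / 2)%:E)%E.
  by near: n; exact: (ereal_cvg0_le eta20 cp).
have hm : (L1_dist T (fun z t => step_kernel (fun i j => bm n i j t) z) betam <= (eta / 2)%:E)%E.
  by near: n; exact: (ereal_cvg0_le eta20 cm).
have ha : K.+1%:R / (2 * eta) <= a n.
  by near: n; move/cvgryPge : aoo; exact.
have hb : forall i j : 'I_n, bounded_left_continuous T (bp n i j) /\
     bounded_left_continuous T (bm n i j) by near: n.
have [M hM] : exists M, forall ij : 'I_n * 'I_n, forall t, t \in `[0, T] ->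
    bp n ij.1 ij.2 t <= M /\ bm n ij.1 ij.2 t <= M.
  apply: finite_upper_bound => [ij M N MN h t tT|[i j] /=].
    by have [h1 h2] := h t tT; split; exact: le_trans MN.
  have [[[M1 h1] _] [[M2 h2] _]] := hb i j; exists (Num.max M1 M2) => t tT.
  rewrite !le_max (le_trans (ler_norm _) (h1 t tT)).
  by rewrite (le_trans (ler_norm _) (h2 t tT)) orbT.
have bpM i j t : t \in `[0, T] -> c <= bp n i j t <= M.
  by move=> tT; have [-> _] := bc n i j t tT; have [-> _] := hM (i, j) t tT.
have bmM i j t : t \in `[0, T] -> c <= bm n i j t <= M.
  by move=> tT; have [_ ->] := bc n i j t tT; have [_ ->] := hM (i, j) t tT.
have := mean_L1_bound T0 an0 c0 d0 n0 (ltn0Sn K) (fun i j => (mb n i j).1)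
  (fun i j => (mb n i j).2) bpM bmM (mq n) (q01 n) (qE n) mp mm p0 m0.
set I := st_integral _ _ => hI.
have hE : (rate_error T (bp n) (bm n) betap betam <= eta%:E)%E.
  by rewrite (splitr eta) EFinD; exact: leeD.
have hKa : K.+1%:R / (2 * a n) <= eta.
  have e20 : 0 < 2 * eta by exact: mulr_gt0.
  have a20 : 0 < 2 * a n by exact: mulr_gt0.
  move: ha; rewrite (ler_pdivrMr _ _ e20) (ler_pdivrMr _ _ a20) => ha.
  by rewrite (_ : eta * _ = a n * (2 * eta)); last by ring.
have : ((2 * c)%:E * I <= (2 * c * delta * T +
    delta^-1 * (eta + (2 * eta + eta)) + (eta + eta))%:E)%E.
  apply: (le_trans hI); rewrite [leRHS]EFinD [(eta + eta)%:E]EFinD.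
  apply: (leeD _ (leeD hE hK)); rewrite [leRHS]EFinD; apply: leeD => //.
  rewrite [leRHS]EFinM; apply: lee_wpmul2l; first by rewrite lee_fin invr_ge0 ltW.
  rewrite [leRHS]EFinD; apply: leeD; first by rewrite lee_fin.
  rewrite [leRHS]EFinD; apply: (leeD _ hK).
  by rewrite [leRHS]EFinM; apply: (lee_wpmul2l _ hE).
have -> : 2 * c * delta * T + delta^-1 * (eta + (2 * eta + eta)) + (eta + eta) =
  2 * c * delta * T + eta * (4 * delta^-1 + 3) - eta by ring.
have -> : eta * (4 * delta^-1 + 3) = c * e by rewrite /eta divfK// gt_eqF.
have -> : 2 * c * delta * T = c * e / 2 by rewrite /delta; field; rewrite gt_eqF.
move=> h; have c20 : 0 < 2 * c by rewrite mulr_gt0.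
rewrite -(lee_pmul2l (x := (2 * c)%:E)) ?lte_fin//.
by apply: (le_trans h); rewrite -EFinM lee_fin; nra.
Unshelve. all: by end_near. Qed.

Lemma cut_dist_ge0 (R : realType) (f g : R * R -> R) : (0 <= cut_dist f g)%E.
Proof.
pose c := `|\int[leb2 R]_(z in set0 `*` set0) (f z - g z)%R%:E|%E.
apply: (@le_trans _ _ c); first exact: abse_ge0.
by apply: ereal_sup_ubound; exists set0, set0; split.
Qed.

Theorem theorem3p10 (R : realType) (T : R) (hT : 0 < T)
  (betap betam : R * R -> R -> R)
  (betanp betanm : forall n : nat, 'I_n -> 'I_n -> R -> R)
  (betap_meas : measurable_fun (space_time T) (fun z => betap z.1 z.2))
  (betam_meas : measurable_fun (space_time T) (fun z => betam z.1 z.2))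
  (beta_ge0 : forall z (t : R), unit_square z -> t \in `[0, T] ->
     0 <= betap z t /\ 0 <= betam z t)
  (betan_meas : forall n (i j : 'I_n),
     measurable_fun (`[0, T]%classic : set R) (betanp n i j) /\
     measurable_fun (`[0, T]%classic : set R) (betanm n i j))
  (beta_L1 : L1_space_time T betap /\ L1_space_time T betam)
  (betan_L1 : forall n, (0 < n)%N ->
     L1_space_time T (fun z t => step_kernel (fun i j => betanp n i j t) z) /\
     L1_space_time T (fun z t => step_kernel (fun i j => betanm n i j t) z))
  (betanp_cvg :
     L1_dist T (fun z t => step_kernel (fun i j => betanp n i j t) z) betap
       @[n --> \oo] --> 0%E)
  (betanm_cvg :
     L1_dist T (fun z t => step_kernel (fun i j => betanm n i j t) z) betam
       @[n --> \oo] --> 0%E)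
  (cbeta : R) (cbeta_gt0 : 0 < cbeta)
  (betan_ge : forall n (i j : 'I_n) (t : R), t \in `[0, T] ->
     cbeta <= betanp n i j t /\ cbeta <= betanm n i j t)
  (beta_lcont : {ae leb2 R, forall z, unit_square z ->
     bounded_left_continuous T (betap z) /\
     bounded_left_continuous T (betam z)})
  (betan_lcont : \forall n \near \oo, forall i j : 'I_n,
     bounded_left_continuous T (betanp n i j) /\
     bounded_left_continuous T (betanm n i j))
  (a : nat -> R) (a_gt0 : forall n, (0 < n)%N -> 0 < a n)
  (a_cvg : a n @[n --> \oo] --> +oo)
  (d : measure_display) (Omega : measurableType d) (P : probability Omega R)
  (x0 : forall n : nat, 'I_n -> 'I_n -> bool)
  (X : forall n : nat, 'I_n -> 'I_n -> R -> Omega -> bool)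
  (X_init : forall n (i j : 'I_n) omega, X n i j 0 omega = x0 n i j)
  (X_chain : forall n (i j : 'I_n),
     markov_chain P T
       (fun t x => a n * (if x then betanm n i j t else betanp n i j t))
       (X n i j))
  (X_indep : forall n,
     mutually_independent P
       (fun ij : 'I_n * 'I_n => history (X n ij.1 ij.2) T)) :
  let H n omega t := step_kernel (fun i j => (X n i j t omega)%:R) : R * R -> R in
  let w t z := betap z t / (betap z t + betam z t) in
  {ae P, forall omega,
     (\int[leb1 R]_(t in `[0%R, T]) cut_dist (H n omega t) (w t))%E
       @[n --> \oo] --> 0%E}.

Proof.
move=> H w.
pose q n (i j : 'I_n) t := mean_path P (X n i j) t.
have chain n (i j : 'I_n) := markov_chain_mean hT (X_chain n i j) (X_init n i j).
have qP n (i j : 'I_n) t : t \in `[0, T] -> P (X n i j t @^-1` [set true]) = (q n i j t)%:E.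
  by have [+ _ _ _] := chain n i j; apply.
have q01 n (i j : 'I_n) t : t \in `[0, T] -> 0 <= q n i j t <= 1.
  by have [_ + _ _] := chain n i j; apply.
have mq n (i j : 'I_n) : measurable_fun (`[0, T]%classic : set R) (q n i j).
  by have [_ _ + _] := chain n i j.
have qE n (i j : 'I_n) t : t \in `[0, T] -> q n i j t = (x0 n i j)%:R +
     \int[@lebesgue_measure R]_(u in `[0, t])
       ((1 - q n i j u) * (a n * betanp n i j u) - q n i j u * (a n * betanm n i j u)).
  by have [_ _ _ +] := chain n i j; apply.
have mX n (i j : 'I_n) t : t \in `[0, T] -> measurable_fun setT (X n i j t).
  by have [+ _ _] := X_chain n i j; apply.
have cX n (i j : 'I_n) omega : cadlag T (X n i j ^~ omega).
  by have [_ + _] := X_chain n i j; apply.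
have p0 : st_nonneg T betap by move=> z t Qz tT; have [] := beta_ge0 z t Qz tT.
have m0 : st_nonneg T betam by move=> z t Qz tT; have [] := beta_ge0 z t Qz tT.
have L1 := mean_L1_cvg hT cbeta_gt0 a_gt0 a_cvg betap_meas betam_meas p0 m0
  beta_L1.1 beta_L1.2 beta_lcont betan_meas betan_ge betan_lcont betanp_cvg betanm_cvg mq q01 qE.
(* Countably many thresholds, so that one null set serves them all. *)
pose eps (k : nat) : R := k.+1%:R^-1.
have eps01 k : 0 < eps k <= 1.
  by rewrite /eps invr_gt0 ltr0n invf_le1 ?ltr0n// ler1n.
have cutk k := cut_partition_ae_cvg hT (eps01 k) mX cX mq qP X_indep.
have : {ae P, forall omega, forall k, (\int[@lebesgue_measure R]_(t in `[0%R, T])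
     (cut_partition (eps k / 4) (eps k) (fun i j => (X n i j t omega)%:R - q n i j t)%R)%:E)%E
     @[n --> \oo] --> 0%E} by apply/ae_foralln.
apply: filterS => omega hcut; apply: cvg0_ereal => [n|e e0].
  by apply: integral_ge0 => t _; exact: cut_dist_ge0.
have e30 : 0 < e / 3 by rewrite divr_gt0.
pose k := Num.truncn (3 * T / e).
have hk : eps k * T <= e / 3.
  have : 3 * T / e <= k.+1%:R := ltW (truncnS_gt _).
  by rewrite ler_pdivrMr// => h; rewrite /eps mulrC ler_pdivrMr ?ltr0n//; lra.
have [ek0 ek1] := andP (eps01 k).
have hcutk := ereal_cvg0_le e30 (hcut k).
have hL1 := ereal_cvg0_le e30 L1.
near=> n.
have n0 : (0 < n)%N by near: n; exact: nbhs_infty_gt.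
have hlam : 1 <= eps k / 4 * n%:R ^+ 2.
  have hn : (4 * k.+1 <= n)%N by near: n; exact: nbhs_infty_ge.
  rewrite /eps -invfM mulrC ler_pdivlMr ?mulr_gt0// mul1r -natrM -natrX ler_nat mulnC.
  by rewrite (leq_trans hn)// -mulnn leq_pmulr.
have hG : (\int[@lebesgue_measure R]_(t in `[0%R, T])
    (cut_partition (eps k / 4) (eps k) (fun i j => (X n i j t omega)%:R - q n i j t)%R)%:E
    <= (e / 3)%:E)%E by near: n.
have hJ : (st_integral T (fun z t => `|step_kernel (fun i j => q n i j t) z -
    ratio betap betam z t|)%R <= (e / 3)%:E)%E by near: n.
pose f z t := `|step_kernel (fun i j => q n i j t) z - ratio betap betam z t|.
pose G t := cut_partition (eps k / 4) (eps k) (fun i j => (X n i j t omega)%:R - q n i j t).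
pose J t := (\int[leb2 R]_(z in @unit_square R) (f z t)%:E)%E.
have mf : st_measurable T f.
  apply: measurableT_comp => //; apply: measurable_funB; first exact: st_measurable_step.
  apply: measurable_fun_div => //; first exact: measurable_space_time.
    exact: measurable_funD.
  by move=> z [Qz tT]; rewrite addr_ge0 ?p0 ?m0.
have f0 : st_nonneg T f by move=> z t _ _; exact: normr_ge0.
have [_ mJ _ fE] := tonelli_space_time mf f0.
rewrite -/(st_integral T f) in fE.
have mG : measurable_fun (`[0, T]%classic : set R) G.
  apply: measurable_cut_partition => i j; apply: measurable_funB => //.
  have mXij : measurable_fun ([set: Omega] `*` `[0, T]%classic)
      (fun z : Omega * R => (X n i j z.2 z.1)%:R : R).
    apply: measurable_right_continuous => // [t|w' t]; first exact: mX.
    by have [+ _] := cX n i j w'; exact.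
  exact: (measurable_slice2 measurableT (measurable_itv _)
    (f := fun w' t => (X n i j t w')%:R : R) (x := omega) mXij I).
have G0 t : 0 <= G t by exact: cut_partition_ge0.
(* Threshold, fluctuation and bias get [e / 3] each; all three are measurable in time. *)
apply: (@le_trans _ _ (\int[@lebesgue_measure R]_(t in `[0%R, T])
    (((eps k)%:E + (G t)%:E) + J t))%E).
  apply: ge0_le_lower_integral => t tT; first exact: cut_dist_ge0.
  rewrite -EFinD; apply: cut_dist_step_kernel_le => //.
    apply: (st_measurable_slice1 (f := ratio betap betam) _ tT).
    apply: measurable_fun_div => //; first exact: measurable_space_time.
      exact: measurable_funD.
    by move=> z [Qz sT]; rewrite addr_ge0 ?p0 ?m0.
  move=> z Qz; have /andP[r0 r1] := ratio_bounds (p0 z t Qz tT) (m0 z t Qz tT).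
  by rewrite ger0_norm.
have hJ' : (\int[@lebesgue_measure R]_(t in `[0%R, T]) J t <= (e / 3)%:E)%E.
  by move: hJ; rewrite -[st_integral _ _]/(st_integral T f) fE.
have hC : (\int[@lebesgue_measure R]_(t in `[0%R, T]) (eps k)%:E <= (e / 3)%:E)%E.
  by rewrite integral_cst//= lebesgue_measure_itv /= lte_fin hT oppr0 adde0 -EFinM lee_fin.
have mI : measurable (`[0%R, T]%classic : set (measurableTypeR R)) by exact: measurable_itvR.
have mGE : measurable_fun (`[0%R, T]%classic : set (measurableTypeR R)) (fun t => (G t)%:E).
  exact/measurable_EFinP.
have J0 t : (0 <= J t)%E by apply: integral_ge0 => z _; rewrite lee_fin normr_ge0.
rewrite ge0_integralD//; last 2 first.
- by move=> t _; rewrite -EFinD lee_fin addr_ge0// ltW.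
- by apply: emeasurable_funD => //; exact: measurable_cst.
rewrite ge0_integralD//; last 2 first.
- by move=> t _; rewrite lee_fin ltW.
- by move=> t _; rewrite lee_fin G0.
apply: (le_trans (leeD (leeD hC hG) hJ')).
by rewrite -!EFinD lee_fin; lra.
Unshelve. all: by end_near. Qed.
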